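(* Let $k\ge2$, $0\le\alpha<1$, and let $G$ be a $k$-uniform hypertree with $m$ edges and exactly $t\ge2$ pendant edges. Then $\rho_\alpha(G)\le\rho_\alpha(T_{m,t,k})$, with equality if and only if $G\cong T_{m,t,k}$.
   Context: Hypergraphs are finite with edges being sets; $k$-uniform means every edge has $k$ vertices; the degree of a vertex is the number of edges containing it. $\mathcal A_\alpha(G)=\alpha\mathcal D(G)+(1-\alpha)\mathcal A(G)$, where $\mathcal A(G)$ is the order-$k$ tensor with $(i_1,\dots,i_k)$-entry $\frac1{(k-1)!}$ if $\{i_1,\dots,i_k\}\in E(G)$ and $0$ otherwise, and $\mathcal D(G)$ is the diagonal tensor of degrees; for an order-$k$ tensor $\mathcal T$, $(\mathcal Tx)_i=\sum_{i_2,\dots,i_k}\mathcal T_{ii_2\dots i_k}x_{i_2}\cdots x_{i_k}$ and $\lambda$ is an eigenvalue if $\mathcal Tx=\lambda x^{[k-1]}$ for some $x\ne0$; $\rho_\alpha(G)$ is the largest modulus of an eigenvalue of $\mathcal A_\alpha(G)$. A path is an alternating sequence of distinct vertices and distinct edges $(v_0,e_1,\dots,e_s,v_s)$ with $v_{i-1},v_i\in e_i$, of length $s$; a cycle is such a sequence with at least two distinct edges and distinct vertices except $v_0=v_s$; a hypertree is a connected hypergraph with no cycles. A pendant edge is an edge $e$ containing a vertex $v_0$ with $d(v_0)\ge2$ such that all other vertices of $e$ have degree $1$. A pendant path of length $s$ at $v_0$ is a path $(v_0,e_1,v_1,\dots,e_s,v_s)$ with $d(v_0)\ge2$, $d(v_i)=2$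 for $1\le i\le s-1$, $d(v_s)=1$, and all vertices of $e_i$ other than $v_{i-1},v_i$ of degree $1$. For $2\le t\le m$, $T_{m,t,k}$ is the $k$-uniform hypertree consisting of $t$ loose paths sharing exactly one common end vertex (and otherwise vertex-disjoint), of which $t-(m-t\lfloor m/t\rfloor)$ have length $\lfloor m/t\rfloor$ and $m-t\lfloor m/t\rfloor$ have length $\lfloor m/t\rfloor+1$; here a loose path of length $\ell$ is $(w_0,f_1,w_1,\dots,f_\ell,w_\ell)$ where each $f_i$ consists of $w_{i-1},w_i$ and $k-2$ further vertices, all vertices distinct except as stated. In particular $T_{m,2,k}$ is the loose path with $m$ edges. *)

(* Defs.v *)
From HB Require Import structures.
From mathcomp Require Import all_boot all_order all_algebra.
Set Implicit Arguments. Unset Strict Implicit. Unset Printing Implicit Defensive.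
Import Order.TTheory GRing.Theory Num.Theory.
Local Open Scope ring_scope.

Notation hgraph n := {set {set 'I_n}}.

Definition uniform (n k : nat) (G : hgraph n) : Prop :=
  forall e, e \in G -> #|e| = k.

Definition deg (n : nat) (G : hgraph n) (v : 'I_n) : nat :=
  #|[set e in G | v \in e]|.

(* Path (v0, e1, v1, ..., es, vs) encoded as v0, vs = [v1;...;vs], es = [e1;...;es]. *)
Definition hpath (n : nat) (G : hgraph n) (v0 : 'I_n) (vs : seq 'I_n)
    (es : seq {set 'I_n}) : Prop :=
  [/\ size vs = size es, uniq (v0 :: vs), uniq es, all (mem G) es &
      (forall i, (i < size es)%N ->
        (nth v0 (v0 :: vs) i \in nth set0 es i) /\ (nth v0 vs i \in nth set0 es i))].

Definition hcycle (n : nat) (G : hgraph n) (v0 : 'I_n) (vs : seq 'I_n)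
    (es : seq {set 'I_n}) : Prop :=
  [/\ size vs = size es /\ (2 <= size es)%N, uniq (take (size es) (v0 :: vs)),
      last v0 vs = v0, (uniq es /\ all (mem G) es) &
      (forall i, (i < size es)%N ->
        (nth v0 (v0 :: vs) i \in nth set0 es i) /\ (nth v0 vs i \in nth set0 es i))].

Definition hconnected (n : nat) (G : hgraph n) : Prop :=
  forall u v : 'I_n, exists vs es, hpath G u vs es /\ last u vs = v.

Definition hypertree (n : nat) (G : hgraph n) : Prop :=
  hconnected G /\ ~ (exists v0 vs es, hcycle G v0 vs es).

Definition pendant (n : nat) (G : hgraph n) (e : {set 'I_n}) : bool :=
  (e \in G) && [exists v0 in e, (2 <= deg G v0)%N &&
                  [forall v in e, (v != v0) ==> (deg G v == 1%N)]].

Definition pendant_edges (n : nat) (G : hgraph n) : {set {set 'I_n}} :=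
  [set e | pendant G e].

Definition hiso (n n' : nat) (G : hgraph n) (H : hgraph n') : Prop :=
  exists f : 'I_n -> 'I_n', bijective f /\
    forall e : {set 'I_n}, (e \in G) = (f @: e \in H).

(* Order-k tensors on 'I_n: T i f is the entry (i, f 0, ..., f (k-2)). *)
Definition tensor (C : numClosedFieldType) (n k : nat) :=
  'I_n -> {ffun 'I_k.-1 -> 'I_n} -> C.

Definition tapply (C : numClosedFieldType) (n k : nat) (T : tensor C n k)
    (x : 'I_n -> C) (i : 'I_n) : C :=
  \sum_(f : {ffun 'I_k.-1 -> 'I_n}) T i f * \prod_(j < k.-1) x (f j).

Definition is_eigenvalue (C : numClosedFieldType) (n k : nat) (T : tensor C n k)
    (l : C) : Prop :=
  exists x : 'I_n -> C, (exists i, x i != 0) /\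
    forall i, tapply T x i = l * x i ^+ k.-1.

Definition spectral_radius (C : numClosedFieldType) (n k : nat) (T : tensor C n k)
    (r : C) : Prop :=
  (exists l, is_eigenvalue T l /\ `|l| = r) /\
  forall mu, is_eigenvalue T mu -> `|mu| <= r.

Definition adj_tensor (C : numClosedFieldType) (n k : nat) (G : hgraph n)
    : tensor C n k :=
  fun i f => if (i |: [set f j | j : 'I_k.-1]) \in G
             then ((k.-1)`!)%:R^-1 else 0.

Definition deg_tensor (C : numClosedFieldType) (n k : nat) (G : hgraph n)
    : tensor C n k :=
  fun i f => if [forall j, f j == i] then (deg G i)%:R else 0.

Definition A_alpha (C : numClosedFieldType) (n k : nat) (a : C) (G : hgraph n)
    : tensor C n k :=
  fun i f => a * @deg_tensor C n k G i f + (1 - a) * @adj_tensor C n k G i f.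

(* T_{m,t,k} on vertices 'I_(m(k-1)+1): vertex 0 is the common end.  Edge g < m
   (path g mod t, position g div t) owns the fresh block
   {g(k-1)+1, ..., (g+1)(k-1)} and contains in addition the vertex
   link g = 0 if g < t, and the last vertex (g-t+1)(k-1) of edge g-t otherwise. *)
Definition T_link (t k g : nat) : nat :=
  if (g < t)%N then 0%N else ((g - t).+1 * k.-1)%N.

Definition T_edge (m t k : nat) (g : nat) : {set 'I_((m * k.-1).+1)} :=
  [set v : 'I_((m * k.-1).+1) |
     ((g * k.-1 < v)%N && (v <= g.+1 * k.-1)%N) || (val v == T_link t k g)].

Definition Tmtk (m t k : nat) : hgraph ((m * k.-1).+1) :=
  [set T_edge m t k (val g) | g : 'I_m].
Arguments A_alpha {C n} k a G.
Arguments spectral_radius {C n k} T r.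

(* Main.v *)
Require Import Defs.
From HB Require Import structures.
From mathcomp Require Import all_boot all_order all_algebra.
From mathcomp Require Import ring lra zify polyrcf.
Set Implicit Arguments. Unset Strict Implicit. Unset Printing Implicit Defensive.
Import Order.TTheory GRing.Theory Num.Theory.
Local Open Scope ring_scope.

(* Root G at a vertex r where a positive eigenvector x is maximal, keep one child
   branch below every edge, and move all other branches to r.  By the Rayleigh
   principle (AM-GM against the eigenvector of the new tree) the spectral radius does
   not decrease, and it increases if some branch was really moved.  The new tree is a
   star of loose paths, one for each pendant edge of G.  On a path starting at r the
   eigenvalue equation is a one-step recursion w_(j+1) = a + c / (D - w_j) with
   D = lam - a, and the equation at r says that the values w at the lengths of the
   paths add up to lam.  The increments of w decay away from the middle of any two of
   these paths, so balancing two lengths increases the sum, and hence lam.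
   Since C need not contain all real numbers, eigenvectors are not obtained by
   compactness: solving the eigenvalue equations from the leaves to the root expresses
   them by polynomials in lam, and the spectral radius is the largest root of their
   product. *)

(** The recursion for w makes sense only while the weights stay below D. Two legs at a vertex weigh
    at most lam together, and this condition does not depend on where the path that they form is
    cut. So the recursion can be run along the whole path formed by the two longest legs, and every
    transfer of an edge stays in its range. For the same reason a transfer between the legs of a
    two-legged star changes nothing: strictness needs a third leg, and the equality case t = 2 rests
    on the maximality of the eigenvector at the root. Weights at a fixed length decrease in lam. To
    show that the balanced star has the larger parameter, the opposite is assumed and all weights
    are taken at the parameter of the other star. Maximality at r also forces degree at least 2
    there. Only then are the pendant edges exactly the edges with nothing below them, which is what
    the move of branches counts. With K = k - 1, the constant is c = (1-a)^(K+1) / D^(K-1): an inner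
    edge of a path has K - 1 vertices of degree 1, and each contributes a factor D. *)

(** * The real elements of C form a real closed field *)

Record realC (C : numClosedFieldType) := RealC {
  valC :> C; valC_real : valC \is Num.real }.

HB.instance Definition _ (C : numClosedFieldType) := [isSub for @valC C].
HB.instance Definition _ (C : numClosedFieldType) :=
  [Choice of realC C by <:].
HB.instance Definition _ (C : numClosedFieldType) :=
  [SubChoice_isSubIntegralDomain of realC C by <:].
HB.instance Definition _ (C : numClosedFieldType) :=
  [SubIntegralDomain_isSubField of realC C by <:].

Section RealSubfield.
Variable C : numClosedFieldType.
Implicit Types x y : realC C.

Let le x y := valC x <= valC y.
Let lt x y := valC x < valC y.
Let nrm x : realC C := RealC (normr_real (valC x)).

Fact realC_le0_add x y : le 0 x -> le 0 y -> le 0 (x + y).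
Proof. exact: addr_ge0. Qed.
Fact realC_le0_mul x y : le 0 x -> le 0 y -> le 0 (x * y).
Proof. exact: mulr_ge0. Qed.
Fact realC_le0_anti x : le 0 x -> le x 0 -> x = 0.
Proof. move=> h1 h2; apply: val_inj; apply: le_anti.
by apply/andP; split; [exact: h2 | exact: h1]. Qed.
Fact realC_sub_ge0 x y : le 0 (y - x) = le x y.
Proof. exact: subr_ge0. Qed.
Fact realC_le0_total x : le 0 x || le x 0.
Proof. exact: valC_real. Qed.
Fact realC_normN x : nrm (- x) = nrm x.
Proof. by apply: val_inj; exact: normrN. Qed.
Fact realC_ge0_norm x : le 0 x -> nrm x = x.
Proof. by move=> h; apply: val_inj; exact: ger0_norm. Qed.
Fact realC_lt_def x y : lt x y = (y != x) && le x y.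
Proof. by rewrite /lt lt_neqAle eq_sym. Qed.

HB.instance Definition _ := Num.IntegralDomain_isLeReal.Build (realC C)
  realC_le0_add realC_le0_mul realC_le0_anti realC_sub_ge0 realC_le0_total
  realC_normN realC_ge0_norm realC_lt_def.
End RealSubfield.

Section RealClosed.
Variable C : numClosedFieldType.
Implicit Types (x y : realC C) (p : {poly realC C}).

Lemma valC_le x y : (valC x <= valC y) = (x <= y).
Proof. by []. Qed.

Lemma valC_lt x y : (valC x < valC y) = (x < y).
Proof. by []. Qed.

Fact valC_is_zmod_morphism : zmod_morphism (@valC C).
Proof. by []. Qed.
Fact valC_is_monoid_morphism : monoid_morphism (@valC C).
Proof. by []. Qed.
HB.instance Definition _ :=
  GRing.isZmodMorphism.Build (realC C) C (@valC C) valC_is_zmod_morphism.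
HB.instance Definition _ :=
  GRing.isMonoidMorphism.Build (realC C) C (@valC C) valC_is_monoid_morphism.

Let toC p := map_poly (@valC C) p.

Lemma real_quadratic_factor p (z : C) :
  root (toC p) z -> z \isn't Num.real ->
  exists2 d : {poly realC C}, d %| p & size d = 3%N /\ forall x, 0 < d.[x].
Proof.
move=> rz nr.
have sR : z + z^* \is Num.real.
  by apply/CrealP; rewrite rmorphD /= conjCK addrC.
have pR : z * z^* \is Num.real by rewrite -normCK rpredX // normr_real.
have zz : z != z^* by apply: contra nr => /eqP e; apply/CrealP; rewrite -e.
pose d : {poly realC C} := 'X^2 - (RealC sR) *: 'X + (RealC pR)%:P.
have dE : toC d = \prod_(w <- [:: z; z^*]) ('X - w%:P).
  rewrite !big_cons big_nil mulr1 /toC /d.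
  rewrite !(rmorphD, rmorphB, rmorphN) /= map_polyXn linearZ_LR /= map_polyX map_polyC /=.
  rewrite -mul_polyC polyCD polyCM; ring.
exists d.
  rewrite -(dvdp_map (@valC C)) -/(toC _) -/(toC p) dE.
  apply: uniq_roots_dvdp; last by rewrite uniq_rootsE /= inE zz.
    rewrite /= rz andbT /= -[toC p](_ : map_poly (@Num.conj C) (toC p) = _) ?fmorph_root //.
  rewrite -map_poly_comp; apply: eq_map_poly => x /=.
  by apply/CrealP; exact: valC_real.
split.
  rewrite -(size_map_poly (@valC C)) -/(toC _) dE size_prod_XsubC //.
move=> x; rewrite -valC_lt -horner_map /= -/(toC _) dE !big_cons big_nil mulr1.
rewrite !hornerE /=.
have -> : valC x - z^* = (valC x - z)^*.
  by rewrite rmorphB /=; congr (_ - _); apply/esym/CrealP; exact: valC_real.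
rewrite -normCK exprn_gt0 // normr_gt0 subr_eq0.
by apply: contra nr => /eqP <-; exact: valC_real.
Qed.

(** A nonconstant p has a root z in C. A real z lies outside [a, b], so its linear factor has the
    same sign at both ends; a nonreal z gives a quadratic factor that is positive everywhere.
    Dividing by this factor lowers the degree. *)
Lemma sign_change_of_no_root n p a b : (size p <= n)%N -> a <= b ->
  (forall x, a <= x <= b -> ~~ root p x) -> 0 < p.[a] * p.[b].
Proof.
elim: n p => [|n IH] p sp leab nr.
  have p0 : p = 0 by apply/eqP; rewrite -size_poly_eq0 -leqn0.
  by have /negP[] := nr a (introT andP (conj (lexx a) leab)); rewrite p0 root0.
have divp d : d %| p -> (1 < size d)%N -> 0 < d.[a] * d.[b] -> 0 < p.[a] * p.[b].
  move=> dp sd dab.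
  have p0 : p != 0.
    apply/eqP=> p0.
    by have /negP[] := nr a (introT andP (conj (lexx a) leab)); rewrite p0 root0.
  have d0 : d != 0 by rewrite -size_poly_gt0; apply: leq_trans sd.
  have eq := divpK dp.
  have q0 : p %/ d != 0 by apply: contraNneq p0 => h; rewrite -eq h mul0r.
  have h : 0 < (p %/ d).[a] * (p %/ d).[b].
    apply: IH => //.
      rewrite size_divp // leq_subLR; apply: leq_trans sp _.
      by rewrite -add1n leq_add2r; case: (size d) sd => [|[]].
    move=> x hx; apply: contra (nr x hx) => rx.
    by rewrite -eq rootM rx.
  rewrite -eq !hornerM.
  have -> : (p %/ d).[a] * d.[a] * ((p %/ d).[b] * d.[b])
    = ((p %/ d).[a] * (p %/ d).[b]) * (d.[a] * d.[b]) by ring.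
  exact: mulr_gt0.
have [s1|s1] := eqVneq (size (toC p)) 1%N.
  have : (size p <= 1)%N by rewrite -(size_map_poly (@valC C)) -/(toC p) s1.
  move=> /size1_polyC pE; rewrite pE !hornerC -expr2 lt_neqAle sqr_ge0 andbT eq_sym.
  rewrite expf_neq0 //; apply/eqP => p0.
  by have /negP[] := nr a (introT andP (conj (lexx a) leab)); rewrite pE p0 root0.
have /closed_rootP [z rz] := s1.
have [zR|zR] := boolP (z \is Num.real); last first.
  have [d dp [sd dpos]] := real_quadratic_factor rz zR.
  by apply: (divp d) => //; rewrite ?sd // mulr_gt0.
have rw : root p (RealC zR) by rewrite -(fmorph_root (@valC C)).
apply: (divp ('X - (RealC zR)%:P)); rewrite ?dvdp_XsubCl ?size_XsubC //.
rewrite !hornerE.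
set w := RealC zR in rw *.
have : ~~ (a <= w <= b) by apply/negP => /nr; rewrite rw.
rewrite negb_and -!ltNge => /orP[h|h].
  by rewrite mulr_gt0 // subr_gt0 //; apply: lt_le_trans leab.
rewrite -mulrNN mulr_gt0 // opprB subr_gt0 //; exact: le_lt_trans h.
Qed.

Lemma realC_closed : Num.real_closed_axiom (realC C).
Proof.
move=> p a b leab /andP[pa pb].
have [p0|p0] := eqVneq p 0.
  by exists a; rewrite ?lexx ?p0 ?root0.
have [r rE] := closed_field_poly_normal (toC p).
have lc0 : lead_coef (toC p) != 0.
  by rewrite lead_coef_eq0 map_poly_eq0.
have rootE x : root p x = (valC x \in r).
  by rewrite -(fmorph_root (@valC C)) -/(toC p) rE rootZ // root_prod_XsubC.
have [/hasP[z zr /andP[zR zab]]|] := boolP (has (fun z => (z \is Num.real) &&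
    (valC a <= z <= valC b)) r).
  by exists (RealC zR); rewrite ?rootE.
move=> /hasPn hn; exfalso.
have := @sign_change_of_no_root _ p a b (leqnn _) leab.
(* The signs at a and b refute the conclusion, so only the absence of roots remains to be shown. *)
rewrite ltNge mulr_le0_ge0 //; apply: (fun A (h : A) (g : A -> false) => notF (g h)).
move=> x xab; rewrite rootE; apply/negP => /hn; rewrite valC_real /=.
by move: xab; rewrite -!valC_le => ->.
Qed.
End RealClosed.

HB.instance Definition _ (C : numClosedFieldType) :=
  Num.RealField_isClosed.Build (realC C) (@realC_closed C).

(** * Weights of loose paths and the decay of their increments *)

Section LegWeights.
Variables (R : realFieldType) (a c D : R).
Hypotheses (a_ge0 : 0 <= a) (c_gt0 : 0 < c) (D_gt0 : 0 < D).

(* At the spectral parameter D + a, a path of j edges starting at v contributes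
   [legw j] to the eigenvalue equation of v. *)
Fixpoint legw (j : nat) : R := if j is i.+1 then a + c / (D - legw i) else 0.

(** All denominators met in computing [legw n] are positive. *)
Definition leg_ok (n : nat) := forall j, (j < n)%N -> legw j < D.

Lemma leg_ok_le n p : (p <= n)%N -> leg_ok n -> leg_ok p.
Proof. by move=> le ok j jp; apply: ok; apply: leq_trans le. Qed.

Lemma legwS j : legw j < D -> (legw j.+1 - a) * (D - legw j) = c.
Proof. by move=> h /=; field; lra. Qed.

Lemma legw_gt_a j : legw j < D -> a < legw j.+1.
Proof. by move=> h /=; rewrite ltrDl divr_gt0 // subr_gt0. Qed.

Lemma legw_ltS n j : leg_ok n -> (j < n)%N -> legw j < legw j.+1.
Proof.
move=> ok; elim: j => [|j IH] jn.
  by apply: le_lt_trans (a_ge0) _; apply: legw_gt_a.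
have IH' := IH (ltnW jn); have h1 := ok _ jn; have h2 := ok _ (ltnW jn).
have -> k : legw k.+1 = a + c / (D - legw k) by [].
rewrite ltrD2l ltr_pM2l // ltf_pV2 ?posrE ?subr_gt0 //.
by rewrite ltrD2l ltrN2.
Qed.

Lemma legw_mono n i j : leg_ok n -> (i <= j <= n)%N -> legw i <= legw j.
Proof.
move=> ok /andP[ij jn]; elim: j ij jn => [|j IH].
  by rewrite leqn0 => /eqP->.
rewrite leq_eqVlt => /orP[/eqP->//|ij] jn.
by apply: le_trans (IH ij (ltnW jn)) (ltW (legw_ltS ok jn)).
Qed.

Lemma legw_ltmono n i j : leg_ok n -> (i < j <= n)%N -> legw i < legw j.
Proof.
move=> ok /andP[ij jn]; apply: lt_le_trans (legw_ltS ok (leq_trans ij jn)) _.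
by apply: (legw_mono ok); rewrite ij.
Qed.

(** Both inequalities say c <= (D - legw p) * (D - legw q), which is symmetric in p and q: the
    vertex that separates the two legs may slide along the path. *)
Lemma legw_shift p q : legw p < D -> legw q < D ->
  (legw p.+1 + legw q <= D + a) = (legw p + legw q.+1 <= D + a).
Proof.
move=> hp hq.
have -> : (legw p.+1 + legw q <= D + a) = (c <= (D - legw p) * (D - legw q)).
  rewrite -(legwS hp) mulrC ler_pM2l ?subr_gt0 //; apply/idP/idP; lra.
have -> : (legw p + legw q.+1 <= D + a) = (c <= (D - legw p) * (D - legw q)).
  rewrite -(legwS hq) ler_pM2r ?subr_gt0 //; apply/idP/idP; lra.
by [].
Qed.

Lemma legw_shift_lt p q : legw p < D -> legw q < D ->
  (legw p.+1 + legw q < D + a) = (legw p + legw q.+1 < D + a).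
Proof.
move=> hp hq.
have -> : (legw p.+1 + legw q < D + a) = (c < (D - legw p) * (D - legw q)).
  rewrite -(legwS hp) mulrC ltr_pM2l ?subr_gt0 //; apply/idP/idP; lra.
have -> : (legw p + legw q.+1 < D + a) = (c < (D - legw p) * (D - legw q)).
  rewrite -(legwS hq) ltr_pM2r ?subr_gt0 //; apply/idP/idP; lra.
by [].
Qed.

(* Two legs of lengths p and q at a vertex form a path of length p + q. *)
Lemma legw_merge p q : leg_ok p -> leg_ok q -> legw p + legw q <= D + a ->
  leg_ok (p + q) /\ legw (p + q) <= D + a.
Proof.
elim: q p => [|q IH] p okp okq h.
  by rewrite addn0; split=> //; move: h => /=; rewrite addr0.
have hq := okq q (ltnSn q).
(* The second leg weighs more than a, which leaves less than D for the first; so the first leg can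
   be lengthened by an edge. *)
have hp : legw p < D by have := legw_gt_a hq; lra.
rewrite -addSnnS; apply: IH.
- by move=> j; rewrite ltnS leq_eqVlt => /orP[/eqP->//|]; apply: okp.
- exact: leg_ok_le okq.
- by rewrite legw_shift.
Qed.

Lemma legw_merge_lt p q : leg_ok p -> leg_ok q -> legw p + legw q < D + a ->
  legw (p + q) < D + a.
Proof.
elim: q p => [|q IH] p okp okq h.
  by rewrite addn0; move: h => /=; rewrite addr0.
have hq := okq q (ltnSn q).
have hp : legw p < D by have := legw_gt_a hq; lra.
rewrite -addSnnS; apply: IH.
- by move=> j; rewrite ltnS leq_eqVlt => /orP[/eqP->//|]; apply: okp.
- exact: leg_ok_le okq.
- by rewrite legw_shift_lt.
Qed.

Variable N : nat.
Hypotheses (okN : leg_ok N) (wN : legw N <= D + a).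

(** Converse of [legw_merge]: start with the whole path as one leg and slide the cut vertex inwards,
    one [legw_shift] per edge. *)
Lemma legw_pair p q : (p + q <= N)%N -> legw p + legw q <= D + a.
Proof.
suff h k q' : (q' <= k)%N -> (k <= N)%N -> legw k <= D + a ->
    legw (k - q') + legw q' <= D + a.
  move=> pq; have := h (p + q)%N q (leq_addl _ _) pq.
  rewrite addnK; apply.
  by apply: le_trans wN; apply: (legw_mono okN); rewrite pq leqnn.
elim: q' => [|q' IH] qk kN hk; first by rewrite subn0 /= addr0.
have := IH (ltnW qk) kN hk.
rewrite -{1}(subnSK qk) legw_shift //; apply: okN; lia.
Qed.

Lemma legw_pair_lt p q : legw N < D + a -> (p + q <= N)%N ->
  legw p + legw q < D + a.
Proof.
move=> wN'.
suff h k q' : (q' <= k)%N -> (k <= N)%N -> legw k < D + a ->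
    legw (k - q') + legw q' < D + a.
  move=> pq; have := h (p + q)%N q (leq_addl _ _) pq.
  rewrite addnK; apply.
  by apply: le_lt_trans wN'; apply: (legw_mono okN); rewrite pq leqnn.
elim: q' => [|q' IH] qk kN hk; first by rewrite subn0 /= addr0.
have := IH (ltnW qk) kN hk.
rewrite -{1}(subnSK qk) legw_shift_lt //; apply: okN; lia.
Qed.

(** Difference of two consecutive instances of [legwS]. The ratio of successive increments is (w -
    a) / (D - w), with w the weight between them. *)
Lemma legw_diffS j : (j.+2 <= N)%N ->
  (legw j.+2 - legw j.+1) * (D - legw j.+1) =
  (legw j.+1 - legw j) * (legw j.+1 - a).
Proof.
move=> jN; have h1 := okN (ltnW jN); have h2 := okN jN.
have e1 := legwS h1; have e2 := legwS h2; lra.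
Qed.

(* The increments of [legw] decay away from the middle of a path; the ratios at
   two mirror positions multiply to at most 1. *)
Lemma legw_concave d s : (s + s + d.+1 <= N)%N ->
  legw (s + d).+1 - legw (s + d) <= legw s.+1 - legw s.
Proof.
(* d drops by two while s rises by one: the two increments that are compared move towards the middle
   of the path. *)
elim/ltn_ind: d s => -[|[|d]] IH s hN; first by rewrite addn0.
  rewrite addn1; have e := @legw_diffS s ltac:(clear - hN; lia).
  have h := @legw_pair s.+1 s.+1 ltac:(clear - hN; lia).
  have h1 : legw s < legw s.+1 by apply: (legw_ltS okN); clear - hN; lia.
  have h2 : legw s.+1 < D by apply: okN; clear - hN; lia.
  rewrite -(ler_pM2r (_ : 0 < D - legw s.+1)) ?subr_gt0 // e ler_pM2l ?subr_gt0 //.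
  lra.
have IH' := IH d ltac:(clear - hN; lia) s.+1 ltac:(clear - hN; lia).
rewrite !addSn in IH'; rewrite !addnS.
have e1 := @legw_diffS s ltac:(clear - hN; lia).
have e2 := @legw_diffS (s + d).+1 ltac:(clear - hN; lia).
have h := @legw_pair s.+1 (s + d).+2 ltac:(clear - hN; lia).
have h1 : legw s < legw s.+1 by apply: (legw_ltS okN); clear - hN; lia.
have h2 : legw s.+1 < D by apply: okN; clear - hN; lia.
have h3 : legw (s + d).+2 < D by apply: okN; clear - hN; lia.
have h4 : a < legw s.+1 by apply: legw_gt_a; apply: okN; clear - hN; lia.
have h5 : a < legw (s + d).+2 by apply: legw_gt_a; apply: okN; clear - hN; lia.
set A := legw s in h1 e1 IH' *; set B := legw s.+1 in h h1 h2 h4 e1 IH' *.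
set B2 := legw s.+2 in IH' e1 *.
set P1 := legw (s + d).+1 in IH' e2 *; set P2 := legw (s + d).+2 in h h3 h5 e2 IH' *.
set P3 := legw _.+3 in e2 *.
rewrite -(ler_pM2r (_ : 0 < D - P2)) ?subr_gt0 // e2.
apply: le_trans (_ : (B2 - B) * (P2 - a) <= _); first by rewrite ler_pM2r ?subr_gt0.
rewrite -(ler_pM2r (_ : 0 < D - B)) ?subr_gt0 // mulrAC e1 -!mulrA.
(* [h] bounds B - a by D - P2 and P2 - a by D - B. *)
rewrite ler_pM2l ?subr_gt0 //; apply: ler_pM; lra.
Qed.

(** Only the outermost ratios need a strict comparison; the inner increments are handled by
    [legw_concave]. *)
Lemma legw_concave_lt d s : legw N < D + a -> (s + s + d.+2 <= N)%N ->
  legw (s + d).+2 - legw (s + d).+1 < legw s.+1 - legw s.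
Proof.
move=> wN' hN.
have e1 := @legw_diffS s ltac:(clear - hN; lia).
have h1 : legw s < legw s.+1 by apply: (legw_ltS okN); clear - hN; lia.
have h2 : legw s.+1 < D by apply: okN; clear - hN; lia.
have h4 : a < legw s.+1 by apply: legw_gt_a; apply: okN; clear - hN; lia.
case: d hN => [|d] hN.
  rewrite addn0; have h := @legw_pair_lt s.+1 s.+1 wN' ltac:(clear - hN; lia).
  rewrite -(ltr_pM2r (_ : 0 < D - legw s.+1)) ?subr_gt0 // e1 ltr_pM2l ?subr_gt0 //.
  lra.
have IH' := @legw_concave d s.+1 ltac:(clear - hN; lia).
rewrite !addSn in IH'; rewrite !addnS.
have e2 := @legw_diffS (s + d).+1 ltac:(clear - hN; lia).
have h := @legw_pair_lt s.+1 (s + d).+2 wN' ltac:(clear - hN; lia).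
have h3 : legw (s + d).+2 < D by apply: okN; clear - hN; lia.
have h5 : a < legw (s + d).+2 by apply: legw_gt_a; apply: okN; clear - hN; lia.
set A := legw s in h1 e1 IH' *; set B := legw s.+1 in h h1 h2 h4 e1 IH' *.
set B2 := legw s.+2 in IH' e1 *.
set P1 := legw (s + d).+1 in IH' e2 *; set P2 := legw (s + d).+2 in h h3 h5 e2 IH' *.
set P3 := legw _.+3 in e2 *.
rewrite -(ltr_pM2r (_ : 0 < D - P2)) ?subr_gt0 // e2.
apply: le_lt_trans (_ : (B2 - B) * (P2 - a) < _); first by rewrite ler_pM2r ?subr_gt0.
rewrite -(ltr_pM2r (_ : 0 < D - B)) ?subr_gt0 // mulrAC e1 -!mulrA.
rewrite ltr_pM2l ?subr_gt0 //; apply: ltr_pM; lra.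
Qed.

Lemma legw_transfer l s : (s.+2 <= l)%N -> (l + s <= N)%N ->
  legw l + legw s <= legw l.-1 + legw s.+1.
Proof.
move=> sl lN; have := @legw_concave (l.-1 - s) s ltac:(lia).
have -> : (s + (l.-1 - s) = l.-1)%N by lia.
have -> : l.-1.+1 = l by lia.
lra.
Qed.

Lemma legw_transfer_lt l s : legw N < D + a -> (s.+2 <= l)%N -> (l + s <= N)%N ->
  legw l + legw s < legw l.-1 + legw s.+1.
Proof.
move=> wN' sl lN; have := @legw_concave_lt (l - s.+2) s wN' ltac:(lia).
have -> : ((s + (l - s.+2)).+2 = l)%N by lia.
have -> : ((s + (l - s.+2)).+1 = l.-1)%N by lia.
lra.
Qed.

End LegWeights.

(** A larger lam means a smaller c and a larger D. The primed parameters are those of the smaller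
    lam, and admissibility passes from them to the larger one. *)
Lemma legw_param_mono (R : realFieldType) (a c D c' D' : R) n : 
  0 <= a -> 0 < c -> 0 < D -> c <= c' -> D' <= D -> leg_ok a c' D' n ->
  leg_ok a c D n /\ forall j, (j <= n)%N -> legw a c D j <= legw a c' D' j.
Proof.
move=> a0 c0 D0 cc DD ok.
have h j : (j <= n)%N -> legw a c D j <= legw a c' D' j.
  elim: j => [|j IH] jn //=; rewrite lerD2l.
  have h1 := IH (ltnW jn); have h2 := ok j jn.
  apply: ler_pM => //; first exact: ltW.
    by rewrite invr_ge0; lra.
  rewrite lef_pV2 ?posrE; lra.
split=> // j jn; apply: le_lt_trans (h j (ltnW jn)) _.
by apply: lt_le_trans (ok j jn) DD.
Qed.

(** * Balancing lengths by transfers of one unit *)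

Section Balance.
Variables (I : finType) (A : {set I}).
Implicit Types (h : I -> nat) (i j : I).

Definition balanced h := forall i j, i \in A -> j \in A -> (h i <= (h j).+1)%N.

Definition transfer h i j x :=
  if x == i then (h i).-1 else if x == j then (h j).+1 else h x.

Lemma transfer_sum (V : nmodType) (phi : nat -> V) h i j :
  i \in A -> j \in A -> i != j ->
  \sum_(x in A) phi (transfer h i j x) =
    phi (h i).-1 + phi (h j).+1 + \sum_(x in A | (x != i) && (x != j)) phi (h x).
Proof.
move=> iA jA ij; rewrite (bigD1 i) //= (bigD1 j) /=; last by rewrite jA eq_sym.
rewrite addrA /transfer eqxx [j == i]eq_sym (negbTE ij) eqxx; congr (_ + _).
apply: eq_big => [x|x]; first by rewrite andbA.
by move=> /andP[/andP[_ /negbTE->] /negbTE->].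
Qed.

Lemma sum_two (V : nmodType) (phi : nat -> V) h i j :
  i \in A -> j \in A -> i != j ->
  \sum_(x in A) phi (h x) =
    phi (h i) + phi (h j) + \sum_(x in A | (x != i) && (x != j)) phi (h x).
Proof.
move=> iA jA ij; rewrite (bigD1 i) //= (bigD1 j) /=; last by rewrite jA eq_sym.
by rewrite addrA; congr (_ + _); apply: eq_bigl => x; rewrite andbA.
Qed.

Lemma balancedPn h : balanced h \/
  exists i j, [/\ i \in A, j \in A, i != j & ((h j).+2 <= h i)%N].
Proof.
have [/forallP H|] := boolP [forall i, forall j, (i \in A) ==> (j \in A) ==> (h i <= (h j).+1)%N].
  by left=> i j iA jA; have /forallP/(_ j) := H i; rewrite iA jA.
rewrite negb_forall => /existsP[i]; rewrite negb_forall => /existsP[j].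
rewrite !negb_imply -ltnNge => /and3P[iA jA hij]; right; exists i, j; split=> //.
by apply: contraTneq hij => ->; rewrite -leqNgt.
Qed.

Lemma balanced_sum (R : pzRingType) (phi : nat -> R) h :
  (0 < #|A|)%N -> balanced h ->
  let m := (\sum_(i in A) h i)%N in
  let q := (m %/ #|A|)%N in let r := (m %% #|A|)%N in
  \sum_(i in A) phi (h i) = phi q *+ (#|A| - r) + phi q.+1 *+ r.
Proof.
move=> A0 bal m q r.
have [i0 i0A] := card_gt0P A0.
have [i iA imin] := @arg_minnP _ i0 (fun x => x \in A) h i0A.
set s := h i in imin.
(* By balance every length is s or s + 1. The minimiser lies outside B, so #|B| < #|A| is the
   remainder of the division. *)
pose B := [set x in A | h x == s.+1].
have hx x : x \in A -> h x = (s + (x \in B))%N.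
  move=> xA; have := imin x xA; have := bal x i xA iA; rewrite -/s inE xA /=.
  by have [->|] := eqVneq (h x) s.+1; lia.
have BA : B \subset A by apply/subsetP => x; rewrite inE => /andP[].
have ltB : (#|B| < #|A|)%N.
  apply: proper_card; rewrite properE BA; apply/subsetPn; exists i => //.
  by rewrite inE iA /= -/s; lia.
have sumB : (\sum_(x in A) (x \in B) = #|B|)%N.
  rewrite -sum1_card big_mkcond [RHS]big_mkcond; apply: eq_bigr => x _.
  by have [/(subsetP BA)->|] := boolP (x \in B) => //; case: (x \in A).
have mE : m = (s * #|A| + #|B|)%N.
  rewrite /m (eq_bigr (fun x => s + (x \in B))%N) //.
  by rewrite big_split /= sumB sum_nat_const mulnC.
have qE : q = s by rewrite /q mE divnMDl // divn_small // addn0.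
have rE : r = #|B| by rewrite /r mE modnMDl modn_small.
rewrite qE rE (bigID (mem B)) /=.
rewrite (eq_bigr (fun=> phi s.+1)); last by move=> x /andP[/hx-> ->]; rewrite addn1.
rewrite [X in _ + X](eq_bigr (fun=> phi s)); last first.
  by move=> x /andP[/hx-> /negbTE->]; rewrite addn0.
rewrite addrC !sumr_const; congr (_ *+ _ + _ *+ _).
  have -> : (#|A| - #|B| = #|A :\: B|)%N by rewrite -(cardsID B A) (setIidPr BA) addKn.
  by apply: eq_card => x; rewrite in_setD [LHS]unfold_in andbC.
apply: eq_card => x; rewrite [LHS]unfold_in /=.
by apply/andP/idP => [[]//|xB]; rewrite xB (subsetP BA).
Qed.

Lemma transfer_sumn h i j : i \in A -> j \in A -> i != j -> (0 < h i)%N ->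
  (\sum_(x in A) transfer h i j x = \sum_(x in A) h x)%N.
Proof.
move=> iA jA ij hi.
have e1 := @transfer_sum nat id h i j iA jA ij.
have e2 := @sum_two nat id h i j iA jA ij.
move: e1 e2; rewrite /GRing.add /= => -> ->; lia.
Qed.

(** Only pairs containing j grow, and h j + 1 <= h i lets the pair with i in place of j bound
    them. *)
Lemma transfer_pairs N h i j : i \in A -> j \in A -> i != j -> (h j < h i)%N ->
  (forall x y, x \in A -> y \in A -> x != y -> (h x + h y <= N)%N) ->
  forall x y, x \in A -> y \in A -> x != y ->
    (transfer h i j x + transfer h i j y <= N)%N.
Proof.
move=> iA jA ij hij hN x y xA yA xy; rewrite /transfer.
have := hN _ _ xA yA xy.
have := hN _ _ iA jA ij.
have [xi|xi] := eqVneq x i; have [yi|yi] := eqVneq y i.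
- by rewrite xi yi eqxx in xy.
- by rewrite xi; have [->|_] := eqVneq y j; lia.
- by rewrite yi; have [->|_] := eqVneq x j; lia.
have [xj|xj] := eqVneq x j; have [yj|yj] := eqVneq y j.
- by rewrite xj yj eqxx in xy.
- by have := hN _ _ iA yA; rewrite eq_sym => /(_ yi); lia.
- by have := hN _ _ iA xA; rewrite eq_sym => /(_ xi); lia.
by [].
Qed.

Lemma balance_le (R : numDomainType) (phi : nat -> R) N h :
  (forall l s, (s.+2 <= l)%N -> (l + s <= N)%N ->
     phi l + phi s <= phi l.-1 + phi s.+1) ->
  (forall i j, i \in A -> j \in A -> i != j -> (h i + h j <= N)%N) ->
  (0 < #|A|)%N ->
  let m := (\sum_(i in A) h i)%N in
  let q := (m %/ #|A|)%N in let r := (m %% #|A|)%N in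
  \sum_(i in A) phi (h i) <= phi q *+ (#|A| - r) + phi q.+1 *+ r.
Proof.
move=> phiT hN A0 /=.
(* A transfer between lengths that differ by at least two lowers the sum of squares. *)
have [n] := ubnP (\sum_(i in A) (h i) ^ 2)%N; elim: n h hN => // n IH h hN hn.
have [bal|[i [j [iA jA ij hij]]]] := balancedPn h; first by rewrite balanced_sum.
rewrite -(@transfer_sumn h i j) //; last by lia.
apply: le_trans (IH (transfer h i j) _ _).
- by rewrite transfer_sum // (sum_two _ _ iA jA ij) lerD2r; apply: phiT => //; apply: hN.
- by apply: transfer_pairs => //; lia.
have e1 := @transfer_sum nat (fun z => z ^ 2)%N h i j iA jA ij.
have e2 := @sum_two nat (fun z => z ^ 2)%N h i j iA jA ij.
move: e1 e2 hn; rewrite /GRing.add /= => -> ->.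
case: (h i) hij => // a; rewrite /= !ltnS => haj; nia.
Qed.

(** One strict transfer followed by [balance_le] puts the balanced value strictly above that of an
    unbalanced h. *)
Lemma balance_lt (R : realDomainType) (phi : nat -> R) N h :
  (forall l s, (s.+2 <= l)%N -> (l + s <= N)%N ->
     phi l + phi s < phi l.-1 + phi s.+1) ->
  (forall i j, i \in A -> j \in A -> i != j -> (h i + h j <= N)%N) ->
  (0 < #|A|)%N ->
  let m := (\sum_(i in A) h i)%N in
  let q := (m %/ #|A|)%N in let r := (m %% #|A|)%N in
  phi q *+ (#|A| - r) + phi q.+1 *+ r <= \sum_(i in A) phi (h i) -> balanced h.
Proof.
move=> phiT hN A0 /=.
have [//|[i [j [iA jA ij hij]]]] := balancedPn h.
rewrite -(@transfer_sumn h i j) //; last by lia.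
rewrite leNgt; case/negP.
apply: lt_le_trans (@balance_le _ phi N (transfer h i j) _ _ A0).
- by rewrite transfer_sum // (sum_two _ _ iA jA ij) ltrD2r; apply: phiT => //; apply: hN.
- by move=> l s h1 h2; apply/ltW/phiT.
by apply: transfer_pairs => //; lia.
Qed.
End Balance.

(** * Eigenvalue equations and positive eigenvectors *)

Section EigenEquation.
Variables (R : pzRingType) (n : nat) (G : hgraph n) (K : nat) (a : R).

Definition nbr_sum (x : 'I_n -> R) v : R :=
  \sum_(e in G | v \in e) \prod_(u in e :\ v) x u.

Definition eigeq (lam : R) (x : 'I_n -> R) := forall v,
  a * (deg G v)%:R * x v ^+ K + (1 - a) * nbr_sum x v = lam * x v ^+ K.
End EigenEquation.

(** An edge at v arises from exactly K! tuples, which cancels the factor 1 / K! of the adjacency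
    tensor. *)
Lemma tapply_A_alpha (C : numClosedFieldType) n K (G : hgraph n) (a : C) x v :
  uniform K.+1 G ->
  tapply (A_alpha K.+1 a G) x v =
    a * (deg G v)%:R * x v ^+ K + (1 - a) * nbr_sum G x v.
Proof.
move=> unif; rewrite /tapply /A_alpha.
under eq_bigr do rewrite mulrDl.
rewrite big_split /=; congr (_ + _).
  rewrite (bigD1 [ffun=> v]) //= [X in _ + X]big1 ?addr0 => [|f fv].
    rewrite /deg_tensor ifT; last by apply/forallP => j; rewrite ffunE.
    rewrite (eq_bigr (fun=> x v)) => [|j _]; last by rewrite ffunE.
    by rewrite prodr_const card_ord.
  rewrite /deg_tensor ifF ?mulr0 ?mul0r //.
  by apply: contraNF fv => /forallP h; apply/eqP/ffunP => j; rewrite ffunE; apply/eqP.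
under eq_bigr do rewrite -mulrA.
rewrite -mulr_sumr; congr (_ * _).
pose im (f : {ffun 'I_K -> 'I_n}) := v |: [set f j | j : 'I_K].
rewrite (bigID (fun f => im f \in G)) /= [X in _ + X]big1 ?addr0; last first.
  by move=> f /negbTE h; rewrite /adj_tensor h mul0r.
rewrite (partition_big im (fun e => (e \in G) && (v \in e))) /=; last first.
  by move=> f ->; rewrite setU11.
apply: eq_bigr => e /andP[eG ve].
have cev : #|e :\ v| = K.
  by have := cardsD1 v e; rewrite ve (unif e eG) => -[].
pose inj : {set {ffun 'I_K -> 'I_n}} :=
  [set f : {ffun 'I_K -> 'I_n} in ffun_on (mem (e :\ v)) | injectiveb f].
have injE f : f \in inj -> [set f j | j : 'I_K] = e :\ v.
  rewrite inE => /andP[/ffun_onP fon /injectiveP fi].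
  apply/eqP; rewrite eqEcard card_imset // cev card_ord leqnn andbT.
  by apply/subsetP => u /imsetP[j _ ->]; apply: fon.
(* The K entries of f have to cover the K vertices of e other than v, so f is a bijection onto
   them. *)
have key f : (im f \in G) && (im f == e) = (f \in inj).
  apply/andP/idP => [[_ /eqP fe]|/injE E]; last first.
    by rewrite /im E setD1K // eqxx.
  have sub : e :\ v \subset [set f j | j : 'I_K].
    by apply/subsetP => u; rewrite -fe /im !inE => /andP[/negbTE->].
  have cim : (#|[set f j | j : 'I_K]| <= K)%N.
    by rewrite -[leqRHS](card_ord K) leq_imset_card.
  have /eqP E : e :\ v == [set f j | j : 'I_K] by rewrite eqEcard sub cev.
  rewrite inE; apply/andP; split.
    apply/ffun_onP => j.
    by have : f j \in [set f j | j : 'I_K] := imset_f _ isT; rewrite -E.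
  have /imset_injP fi : #|[set f j | j in 'I_K]| == #|'I_K| by rewrite -E cev card_ord.
  by apply/injectiveP => i j; apply: fi.
under eq_bigl do rewrite key.
rewrite (eq_bigr (fun=> (K`!)%:R^-1 * \prod_(u in e :\ v) x u)); last first.
  move=> f fI; have := fI; rewrite -key => /andP[iG _].
  rewrite /adj_tensor iG /= -(injE f fI) big_imset //= => i j _ _.
  by move: fI; rewrite inE => /andP[_ /injectiveP]; apply.
rewrite sumr_const card_inj_ffuns_on cev card_ord ffactnn.
by rewrite -mulrnAl -[_ *+ K`!]mulr_natr mulVf ?mul1r // pnatr_eq0 -lt0n fact_gt0.
Qed.

Section PositiveEigenvector.
Variables (C : numClosedFieldType) (n K : nat) (G : hgraph n) (a lam : realC C).
Hypotheses (a_ge0 : 0 <= a) (a_le1 : a <= 1) (lam_ge0 : 0 <= lam).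
Hypothesis unif : uniform K.+1 G.

(** For an eigenpair (mu, y) the moduli of y satisfy the equations of |mu| as inequalities. Scale x
    until it touches |y| from above; at the vertex of contact the equation of x yields |mu| <=
    lam. *)
Lemma spectral_radius_eigeq (x : 'I_n -> realC C) :
  (0 < n)%N -> (forall v, 0 < x v) -> eigeq G K a lam x ->
  spectral_radius (A_alpha K.+1 (valC a) G) (valC lam).
Proof.
move=> n0 x0 ex; split.
  exists (valC lam); split; last exact: ger0_norm.
  exists (fun v => valC (x v)); split.
    by exists (Ordinal n0); rewrite fmorph_eq0; apply/lt0r_neq0.
  move=> v; rewrite tapply_A_alpha //.
  have := congr1 (@valC C) (ex v).
  rewrite rmorphM rmorphXn /= => <-.
  rewrite rmorphXn rmorph_nat; congr (_ + _ * _).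
  by rewrite /nbr_sum rmorph_sum; apply: eq_bigr => e _; rewrite rmorph_prod.
move=> mu [y [[i0 yi0] ey]].
pose z v : realC C := RealC (normr_real (y v)).
pose nu : realC C := RealC (normr_real mu).
have z0 v : 0 <= z v by rewrite -valC_le /= normr_ge0.
have sub v : nu * z v ^+ K <= a * (deg G v)%:R * z v ^+ K + (1 - a) * nbr_sum G z v.
  rewrite -valC_le /= rmorphXn /= -normrX -normrM -ey tapply_A_alpha //.
  apply: le_trans (ler_normD _ _) _.
  rewrite rmorph_nat; apply: lerD.
    by rewrite !normrM normr_nat ger0_norm.
  rewrite normrM ger0_norm; last by rewrite subr_ge0.
  apply: ler_wpM2l; first by rewrite subr_ge0.
  apply: le_trans (ler_norm_sum _ _ _) _.
  rewrite /nbr_sum rmorph_sum; apply: ler_sum => e _.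
  by rewrite rmorph_prod normr_prod.
have [v _ vmax] := @arg_maxP _ _ _ (Ordinal n0) predT (fun v => z v / x v) isT.
pose c := z v / x v.
have c0 : 0 <= c by rewrite divr_ge0 // ltW.
have zc u : z u <= c * x u by rewrite -ler_pdivrMr //; apply: vmax.
have zv : z v = c * x v by rewrite /c divfK // gt_eqF.
have zv0 : 0 < z v.
  have : 0 < z i0 / x i0 by rewrite divr_gt0 // -valC_lt /= normr_gt0.
  move=> /lt_le_trans/(_ (vmax i0 isT)) h.
  by rewrite zv mulr_gt0.
suff : nu <= lam by rewrite -valC_le.
rewrite -(ler_pM2r (exprn_gt0 K zv0)).
apply: le_trans (sub v) _.
have -> : lam * z v ^+ K = c ^+ K * (lam * x v ^+ K) by rewrite zv exprMn; ring.
rewrite -ex zv exprMn mulrDr; apply: lerD.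
  by rewrite le_eqVlt; apply/orP; left; apply/eqP; ring.
have -> : c ^+ K * ((1 - a) * nbr_sum G x v) = (1 - a) * (c ^+ K * nbr_sum G x v) by ring.
apply: ler_wpM2l; first by rewrite subr_ge0.
rewrite /nbr_sum mulr_sumr; apply: ler_sum => e /andP[eG ve].
have cev : #|e :\ v| = K.
  by have := cardsD1 v e; rewrite ve (unif eG) => -[].
rewrite -cev -prodr_const -big_split /=; apply: ler_prod => u _.
by rewrite z0 zc.
Qed.
End PositiveEigenvector.

Lemma spectral_radius_uniq (C : numClosedFieldType) n k (T : tensor C n k) r s :
  spectral_radius T r -> spectral_radius T s -> r = s.
Proof.
move=> [[l [el <-]] hl] [[m [em <-]] hm].
by apply: le_anti; rewrite hm // hl.
Qed.

(** * Invariance under isomorphism *)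

Section Transport.
Variables (n n' : nat) (G : hgraph n) (H : hgraph n') (f : 'I_n -> 'I_n').
Hypotheses (bf : bijective f) (fG : forall e : {set 'I_n}, (e \in G) = (f @: e \in H)).

Let fI : injective f := bij_inj bf.

Lemma imset_bij_preim (e : {set 'I_n'}) : f @: [set v | f v \in e] = e.
Proof.
have [g fK gK] := bf; apply/setP => u; apply/imsetP/idP => [[v]|ue].
  by rewrite inE => fv ->.
by exists (g u); rewrite ?inE gK.
Qed.

Lemma sum_edges_hiso (V : nmodType) (F : {set 'I_n'} -> V) :
  \sum_(e in H) F e = \sum_(e in G) F (f @: e).
Proof.
rewrite (reindex (fun e : {set 'I_n} => f @: e)) /=; first by apply: eq_bigl => e; rewrite fG.
exists (fun e : {set 'I_n'} => [set v | f v \in e]) => e _; last exact: imset_bij_preim.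
by apply/setP => u; rewrite inE mem_imset.
Qed.

Lemma deg_hiso v : deg H (f v) = deg G v.
Proof.
rewrite /deg -!sum1_card.
under eq_bigl do rewrite inE; under [RHS]eq_bigl do rewrite inE.
rewrite big_mkcondr [RHS]big_mkcondr (@sum_edges_hiso nat); apply: eq_bigr => e _.
by rewrite mem_imset.
Qed.

Lemma eigeq_hiso (R : comPzRingType) K (a lam : R) x :
  eigeq H K a lam x -> eigeq G K a lam (x \o f).
Proof.
move=> ex v; have /= <- := ex (f v); rewrite deg_hiso; congr (_ + _ * _).
rewrite /nbr_sum big_mkcondr [RHS]big_mkcondr sum_edges_hiso; apply: eq_bigr => e _.
rewrite mem_imset //; case: ifP => // ve.
have -> : (f @: e) :\ f v = f @: (e :\ v).
  apply/setP => u; rewrite !inE; apply/andP/imsetP => [[ufv /imsetP[w we uw]]|[w]].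
    by exists w => //; rewrite !inE we andbT; apply: contra ufv => /eqP <-; rewrite uw.
  by rewrite !inE => /andP[wv we] ->; rewrite inj_eq // wv imset_f.
by rewrite big_imset //= => u w _ _; apply: fI.
Qed.
End Transport.

(** * The Rayleigh principle for a positive eigenvector *)

Lemma eigeq_mul (R : idomainType) n K (G : hgraph n) (a lam : R) x :
  (forall v, x v != 0) ->
  eigeq G K a lam x <->
  (forall v, a * (deg G v)%:R * x v ^+ K.+1 +
     (1 - a) * \sum_(e in G | v \in e) \prod_(u in e) x u = lam * x v ^+ K.+1).
Proof.
move=> x0.
have E v : x v * nbr_sum G x v = \sum_(e in G | v \in e) \prod_(u in e) x u.
  rewrite mulr_sumr; apply: eq_bigr => e /andP[_ ve].
  by rewrite [RHS](big_setD1 v).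
split=> h v.
  by rewrite -E !exprS mulrCA [RHS]mulrCA -(h v); ring.
apply: (mulfI (x0 v)); rewrite mulrDr [RHS]mulrCA -exprS -(h v) -E exprS; ring.
Qed.

Section Rayleigh.
Variables (R : realFieldType) (n K : nat) (G : hgraph n) (a lam : R) (x z : 'I_n -> R).
Hypotheses (a_le1 : a < 1) (unif : uniform K.+1 G).
Hypotheses (x_gt0 : forall v, 0 < x v) (z_ge0 : forall v, 0 <= z v).
Hypothesis ex : eigeq G K a lam x.

Let s v := z v / x v.

(** Up to a positive factor, the defect in AM-GM for the numbers s u ^+ K.+1 on e; it vanishes
    exactly when z / x is constant on e. *)
Let rayleigh_gap (e : {set 'I_n}) :=
  \prod_(u in e) x u * \sum_(u in e) s u ^+ K.+1 - K.+1%:R * \prod_(u in e) z u.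

Let s_ge0 v : 0 <= s v. Proof. by rewrite divr_ge0 // ltW. Qed.

Let zE (e : {set 'I_n}) : \prod_(u in e) z u = \prod_(u in e) x u * \prod_(u in e) s u.
Proof.
rewrite -big_split; apply: eq_bigr => u _ /=.
by rewrite /s mulrC divfK // gt_eqF.
Qed.

Let rayleigh_gap_ge0 e : e \in G -> 0 <= rayleigh_gap e ?= iff
  [forall u in e, forall v in e, s u == s v].
Proof.
move=> eG; have ce := unif eG.
have px : 0 < \prod_(u in e) x u by apply: prodr_gt0.
have K0 : 0 < K.+1%:R :> R by rewrite ltr0n.
have AG := @leif_AGM R _ e (fun u => s u ^+ K.+1) (fun u _ => exprn_ge0 _ (s_ge0 u)).
rewrite ce prodrXl in AG.
pose M := (\sum_(u in e) s u ^+ K.+1) / K.+1%:R.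
have M0 : 0 <= M by rewrite divr_ge0 ?sumr_ge0 ?ler0n // => u _; rewrite exprn_ge0.
have p0 : 0 <= \prod_(u in e) s u by apply: prodr_ge0.
have gapE : rayleigh_gap e = \prod_(u in e) x u * K.+1%:R * (M - \prod_(u in e) s u).
  rewrite /rayleigh_gap zE /M; move: K0 => /lt0r_neq0.
  by move: (K.+1%:R) => k k0; field.
have condE : [forall u in e, forall v in e, s u == s v] = (\prod_(u in e) s u == M).
  rewrite -(eqrXn2 (ltn0Sn K)) // AG.2.
  apply/forall_inP/forall_inP => h u ue; apply/forall_inP => v ve;
    by have /forall_inP/(_ v ve) := h u ue; rewrite eqrXn2.
rewrite gapE condE; apply/leifP; case: eqVneq => [->|ne].
  by rewrite subrr mulr0.
rewrite !mulr_gt0 // subr_gt0 lt_neqAle ne /=.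
by rewrite -(ler_pXn2r (ltn0Sn K)) ?nnegrE // AG.1.
Qed.

(** Multiplying the equation of x at v by s v ^+ K.+1 and summing over v leaves the form of z plus
    the AM-GM defects of the edges. *)
Let gap_sum :
  lam * \sum_v z v ^+ K.+1 = (1 - a) * \sum_(e in G) rayleigh_gap e +
  (K.+1%:R * (1 - a) * \sum_(e in G) \prod_(u in e) z u
    + a * \sum_v (deg G v)%:R * z v ^+ K.+1).
Proof.
have /(_ (fun v => lt0r_neq0 (x_gt0 v))) [/(_ ex) ex' _] := @eigeq_mul R n K G a lam x.
have zs v : z v ^+ K.+1 = x v ^+ K.+1 * s v ^+ K.+1.
  by rewrite -exprMn /s mulrC divfK // gt_eqF.
have -> : lam * \sum_v z v ^+ K.+1 = \sum_v (lam * x v ^+ K.+1) * s v ^+ K.+1.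
  by rewrite mulr_sumr; apply: eq_bigr => v _; rewrite zs mulrA.
under eq_bigr do rewrite -ex' mulrDl.
rewrite big_split /= addrA addrC; congr (_ + _); last first.
  by rewrite mulr_sumr; apply: eq_bigr => v _; rewrite zs; ring.
rewrite /rayleigh_gap sumrB -mulr_sumr.
have -> : forall A B, (1 - a) * (A - K.+1%:R * B) + K.+1%:R * (1 - a) * B = (1 - a) * A.
  by move=> A B; ring.
under eq_bigr do rewrite -mulrA; rewrite -mulr_sumr; congr (_ * _).
under eq_bigr do rewrite mulr_suml big_mkcondr.
rewrite exchange_big /=; apply: eq_bigr => e eG.
rewrite -big_mkcond mulr_sumr; apply: eq_bigr => v ve /=.
by [].
Qed.

Lemma rayleigh :
  K.+1%:R * (1 - a) * \sum_(e in G) \prod_(u in e) z u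
    + a * \sum_v (deg G v)%:R * z v ^+ K.+1 <= lam * \sum_v z v ^+ K.+1.
Proof.
rewrite gap_sum lerDr mulr_ge0 //; first by rewrite subr_ge0 ltW.
by apply: sumr_ge0 => e eG; rewrite (rayleigh_gap_ge0 eG).
Qed.

Lemma rayleigh_eq :
  lam * \sum_v z v ^+ K.+1 <=
  K.+1%:R * (1 - a) * \sum_(e in G) \prod_(u in e) z u
    + a * \sum_v (deg G v)%:R * z v ^+ K.+1 ->
  forall e u v, e \in G -> u \in e -> v \in e -> z u / x u = z v / x v.
Proof.
rewrite gap_sum gerDr pmulr_rle0 ?subr_gt0 // => le0 e u v eG ue ve.
have ge0 e' : e' \in G -> 0 <= rayleigh_gap e' by move=> /rayleigh_gap_ge0 [].
have /eqP : \sum_(e in G) rayleigh_gap e = 0.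
  by apply: le_anti; rewrite le0 sumr_ge0.
rewrite psumr_eq0 // => /allP /(_ e).
rewrite mem_index_enum eG => /(_ isT) /= /eqP g0.
have [_] := rayleigh_gap_ge0 eG; rewrite g0 eqxx => /esym /forall_inP /(_ u ue).
by move=> /forall_inP /(_ v ve) /eqP.
Qed.
End Rayleigh.

(** * Recursion along a measure, and real roots of polynomials *)

(** [F k] unfolds the recursion k times; once k exceeds the measure of v the result is stable and
    never sees the default d. This serves recursions from the leaves up as well as from the root
    down. *)
Lemma measure_rec (T A : Type) (mu : T -> nat) (d : A) (step : T -> (T -> A) -> A) :
  (forall v f g, (forall u, (mu u < mu v)%N -> f u = g u) -> step v f = step v g) ->
  exists f, forall v, f v = step v f.
Proof.
move=> ext.
pose F := fix F k v := if k is k'.+1 then step v (F k') else d.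
have Fstab k l v : (mu v < k)%N -> (mu v < l)%N -> F k v = F l v.
  elim: k l v => [//|k IH] [//|l] v vk vl /=; apply: ext => u uv; apply: IH; lia.
exists (fun v => F (mu v).+1 v) => v /=.
by apply: ext => u uv; exact: (Fstab (mu v) (mu u).+1 u uv (ltnSn _)).
Qed.

Lemma poly_max_root (R : rcfType) (p : {poly R}) (x b : R) :
  p != 0 -> root p x -> (forall y, b <= y -> ~~ root p y) ->
  exists2 z, root p z & forall y, z < y -> ~~ root p y.
Proof.
move=> p0 rx hb.
have xb : x < b by rewrite ltNge; apply: contraL rx; apply: hb.
have : x \in roots p (x - 1) b by rewrite in_roots rx p0 andbT in_itv /=; lra.
have rE y : (y \in roots p (x - 1) b) = [&& root p y, y \in `]x - 1, b[ & p != 0].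
  by rewrite in_roots.
have max (s : seq R) : x \in s -> exists2 z, z \in s & forall y, y \in s -> y <= z.
  case: s => // y s _; elim: s y => [|y' s IH] y.
    by exists y; rewrite ?mem_head // => w; rewrite inE => /eqP->.
  have [z zs zmax] := IH y'.
  have [yz|zy] := leP y z.
    exists z; first by rewrite inE zs orbT.
    by move=> w; rewrite inE => /orP[/eqP->//|]; apply: zmax.
  exists y; first by rewrite mem_head.
  move=> w; rewrite inE => /orP[/eqP->//|/zmax wz].
  exact: le_trans wz (ltW zy).
move=> xs; have [z zs zmax] := max _ xs.
have := zs; rewrite rE in_itv => /and3P[rz /andP[z1 z2] _].
exists z => // y zy; apply/negP => ry.
have yb : y < b by rewrite ltNge; apply: contraL ry; apply: hb.
have : y \in roots p (x - 1) b.
  by rewrite rE ry p0 andbT in_itv /= yb andbT (lt_trans z1).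
by move=> /zmax; rewrite leNgt zy.
Qed.

(** Stands in for continuity: a negative value at z would force a root above z. *)
Lemma poly_ge0_limit (R : rcfType) (p : {poly R}) (z : R) :
  (forall y, z < y -> 0 < p.[y]) -> 0 <= p.[z].
Proof.
move=> h; rewrite leNgt; apply/negP => pz.
have z1 : z < z + 1 by rewrite ltrDl.
have := @poly_ivt R p z (z + 1) (ltW z1).
rewrite (ltW pz) (ltW (h _ z1)) => /(_ isT) [x /andP[zx _] /rootP px].
move: zx; rewrite le_eqVlt => /orP[/eqP zx|/h]; last by rewrite px ltxx.
by rewrite zx px ltxx in pz.
Qed.

Lemma poly_gt0_of_no_root (R : rcfType) (p : {poly R}) (y b : R) :
  y <= b -> 0 < p.[b] -> (forall w, y <= w -> ~~ root p w) -> 0 < p.[y].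
Proof.
move=> yb pb nr; rewrite ltNge; apply/negP => py.
have := @poly_ivt R p y b yb; rewrite py (ltW pb) => /(_ isT) [x /andP[yx _] px].
by have := nr x yx; rewrite px.
Qed.

(** * Elimination of the eigenvalue equations along a rooted hypertree *)

Section RootedTrees.
Variables (n m K : nat).

(* A hypertree explored from the root r: edge number i consists of the vertex up i,
   at level at most i, and of the block of the K vertices of level i + 1. *)
Record rooted (lvl : 'I_n -> nat) (up : 'I_m -> 'I_n) (r : 'I_n) : Prop := Rooted {
  rooted_lvl0 : forall v, (lvl v == 0%N) = (v == r);
  rooted_lvl_le : forall v, (lvl v <= m)%N;
  rooted_block : forall i : 'I_m, #|[set v | lvl v == i.+1]| = K;
  rooted_up : forall i, (lvl (up i) <= i)%N }.

Definition block (lvl : 'I_n -> nat) (i : 'I_m) : {set 'I_n} := [set v | lvl v == i.+1].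

Definition redge lvl up i := up i |: block lvl i.

Definition rgraph lvl (up : 'I_m -> 'I_n) : hgraph n := [set redge lvl up i | i : 'I_m].

Definition cdeg (up : 'I_m -> 'I_n) (r v : 'I_n) : nat :=
  ((v != r) + #|[set i | up i == v]|)%N.

Section Perron.
Variables (R : rcfType) (a : R) (lvl : 'I_n -> nat) (up : 'I_m -> 'I_n) (r : 'I_n).
Hypotheses (a_ge0 : 0 <= a) (a_lt1 : a < 1) (K0 : (0 < K)%N) (m0 : (0 < m)%N).
Hypothesis rt : rooted lvl up r.

Let b : R := 1 - a.
Let bk : R := b ^+ K.+1.
Let bk_gt0 : 0 < bk. Proof. by rewrite exprn_gt0 // subr_gt0. Qed.

Let P (S : comNzRingType) (F : 'I_n -> S) i := \prod_(u in block lvl i) F u.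
Let Q (S : comNzRingType) (F : 'I_n -> S) v := \prod_(i | up i == v) P F i.
Let W (S : comNzRingType) (F : 'I_n -> S) i := \prod_(u in block lvl i) Q F u.

(* F v / Q F v is the rational function of lam to which the equations below v reduce
   the equation of v. *)
Let step v (F : 'I_n -> {poly R}) : {poly R} :=
  ('X - (a * (cdeg up r v)%:R)%:P) * Q F v -
  \sum_(i | up i == v) bk%:P * W F i * \prod_(j | (up j == v) && (j != i)) P F j.

Let Fexists : exists F, forall v, F v = step v F.
Proof.
apply: (@measure_rec _ {poly R} (fun v => m - lvl v)%N 0) => v f g fg.
have PE (i : 'I_m) : (lvl v <= i)%N -> P f i = P g i.
  move=> vi; apply: eq_bigr => u; rewrite inE => /eqP lu; apply: fg.
  by have := rooted_lvl_le rt u; lia.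
have upv i : up i == v -> (lvl v <= i)%N by move/eqP <-; apply: rooted_up rt i.
congr (_ * _ - _); first by apply: eq_bigr => i /upv; apply: PE.
apply: eq_bigr => i /upv vi; congr (_ * _ * _).
  apply: eq_bigr => u; rewrite inE => /eqP lu; apply: eq_bigr => j /eqP uj.
  by apply: PE; have := rooted_up rt j; rewrite uj lu; lia.
by apply: eq_bigr => j /andP[/upv vj _]; apply: PE.
Qed.

Let Pev (F : 'I_n -> {poly R}) z i : (P F i).[z] = P (fun v => (F v).[z]) i.
Proof. by rewrite horner_prod. Qed.
Let Qev (F : 'I_n -> {poly R}) z v : (Q F v).[z] = Q (fun v => (F v).[z]) v.
Proof. by rewrite horner_prod; apply: eq_bigr => i _; rewrite Pev. Qed.
Let Wev (F : 'I_n -> {poly R}) z i : (W F i).[z] = W (fun v => (F v).[z]) i.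
Proof. by rewrite horner_prod; apply: eq_bigr => u _; rewrite Qev. Qed.

Let rest (f : 'I_n -> R) v i := \prod_(j | (up j == v) && (j != i)) P f j.

Let step_ev F (hF : forall v, F v = step v F) z v :
  let f u := (F u).[z] in
  (F v).[z] = (z - a * (cdeg up r v)%:R) * Q f v
    - \sum_(i | up i == v) bk * W f i * rest f v i.
Proof.
rewrite /= {1}hF /step !hornerE horner_sum Qev; congr (_ - _).
apply: eq_bigr => i _; rewrite !hornerE Wev horner_prod; congr (_ * _).
by apply: eq_bigr => j _; rewrite Pev.
Qed.

Let Qrest (f : 'I_n -> R) v i : up i == v -> Q f v = P f i * rest f v i.
Proof. by move=> iv; rewrite /Q (bigD1 i). Qed.

Let lvl_block u (i j : 'I_m) : u \in block lvl i -> up j == u -> (i < j)%N.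
Proof.
rewrite inE => /eqP lu /eqP uj; have := rooted_up rt j.
by rewrite uj lu.
Qed.

Let block_exists i : exists u, u \in block lvl i.
Proof. by apply/card_gt0P; rewrite (rooted_block rt). Qed.

Let leaf_exists : exists v, forall i, up i != v.
Proof.
have [i _ imax] := @arg_maxnP _ (Ordinal m0) predT (fun i : 'I_m => i : nat) isT.
have [u ui] := block_exists i; exists u => j; apply/negP => /(lvl_block ui).
by have : (j <= i)%N := imax j isT; rewrite leqNgt => /negP.
Qed.

Let downward (T : 'I_n -> Prop) :
  (forall v, (forall u, (lvl v < lvl u)%N -> T u) -> T v) -> forall v, T v.
Proof.
move=> h v; have [k] := ubnP (m - lvl v); elim: k v => // k IH v vk.
apply: h => u vu; apply: IH; have := rooted_lvl_le rt u; lia.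
Qed.

(** Beyond 2m + 2 every F v is at least Q F v: a * cdeg is at most m + 1, and each of the at most m
    edges below v costs at most Q F v. *)
Let B : R := (m + m).+2%:R.

Let large F (hF : forall v, F v = step v F) z : B <= z -> forall v, 0 < (F v).[z].
Proof.
move=> Bz; pose f u := (F u).[z].
suff h v : 0 < Q f v <= f v by move=> v; have /andP[] := h v; apply: lt_le_trans.
elim/downward: v => v IH.
have Pp (i : 'I_m) : (lvl v <= i)%N -> 0 < W f i <= P f i.
  move=> vi; apply/andP; split.
    apply: prodr_gt0 => u; rewrite inE => /eqP lu.
    by have := IH u; rewrite lu ltnS => /(_ vi) /andP[].
  apply: ler_prod => u; rewrite inE => /eqP lu.
  by have := IH u; rewrite lu ltnS => /(_ vi) /andP[/ltW-> ->].
have upv i : up i == v -> (lvl v <= i)%N by move/eqP <-; apply: rooted_up rt i.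
have Pp' i : up i == v -> 0 < P f i.
  by move=> /upv/Pp /andP[]; apply: lt_le_trans.
have Qv : 0 < Q f v by apply: prodr_gt0.
rewrite Qv /= {2}/f step_ev // -/f.
have le1 : \sum_(i | up i == v) bk * W f i * rest f v i <= #|[set i | up i == v]|%:R * Q f v.
  rewrite -sum1dep_card natr_sum mulr_suml; apply: ler_sum => i iv.
  rewrite mul1r (Qrest _ iv) ler_wpM2r //.
    by apply: prodr_ge0 => j /andP[/Pp'/ltW].
  have /andP[/ltW W0 WP] := Pp i (upv i iv).
  apply: le_trans WP; apply: ler_piMl => //.
  by rewrite exprn_ile1 // /b ?subr_ge0 ?lerBlDr ?lerDl // ltW.
apply: le_trans (_ : (z - a * (cdeg up r v)%:R) * Q f v -
  #|[set i | up i == v]|%:R * Q f v <= _); last by lra.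
rewrite -mulrBl -[leLHS]mul1r; apply: ler_wpM2r; first exact: ltW.
set c := #|_|; have cm : (c <= m)%N by rewrite -[leqRHS]card_ord max_card.
have h1 : a * (cdeg up r v)%:R <= (m.+1)%:R.
  apply: le_trans (_ : 1 * (cdeg up r v)%:R <= _); first by rewrite ler_wpM2r // ltW.
  by rewrite mul1r ler_nat /cdeg -/c; case: (_ != _); lia.
have h2 : c%:R <= m%:R :> R by rewrite ler_nat.
move: Bz h1 h2; rewrite /B -!natr1 natrD; lra.
Qed.

(** In units of x v ^+ K.+1, [g v] is what the equation of v leaves for the edge above v, and [bb i]
    is the share of edge i in the equation of [up i]. Here g = F / Q and bb = bk * W / P. As lam
    descends from infinity, the first F to vanish is that of r: no other can vanish there without
    making the equation of the vertex above it negative first. *)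
Theorem perron_recursion : exists lam (g : 'I_n -> R) (bb : 'I_m -> R),
  [/\ g r = 0,
      forall v, v != r -> 0 < g v,
      forall i, 0 < bb i,
      forall i, bb i * \prod_(u in block lvl i) g u = bk &
      forall v, g v = lam - a * (cdeg up r v)%:R - \sum_(i | up i == v) bb i].
Proof.
have [F hF] := Fexists.
pose p := \prod_v F v.
have pE z : p.[z] = \prod_v (F v).[z] by rewrite horner_prod.
have rootp z v : root (F v) z -> root p z.
  by move=> /rootP h; apply/rootP; rewrite pE (bigD1 v) //= h mul0r.
have noroot z : B <= z -> ~~ root p z.
  move=> Bz; rewrite rootE pE prodf_seq_neq0; apply/allP => v _ /=.
  by rewrite gt_eqF // large.
have p0 : p != 0.
  by apply: contraNneq (noroot B (lexx B)) => ->; rewrite root0.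
(* At a vertex with no edge below, F v is linear, nonpositive at 0 and positive at B. *)
have [x rx] : exists x, root p x.
  have [v vleaf] := leaf_exists.
  have : (F v).[0] <= 0.
    rewrite step_ev // big1 => [|i iv]; last by have := vleaf i; rewrite iv.
    rewrite /Q big1 => [|i iv]; last by have := vleaf i; rewrite iv.
    by rewrite sub0r mulr1 subr0 oppr_le0 mulr_ge0.
  move=> h; have := @poly_ivt R (F v) 0 B (ler0n _ _).
  rewrite h (ltW (large hF (lexx B) v)) => /(_ isT)[x _ rx].
  by exists x; apply: rootp rx.
have [z rz zmax] := poly_max_root p0 rx noroot.
have Fpos y v : z < y -> 0 < (F v).[y].
  move=> zy; apply: (@poly_gt0_of_no_root _ _ _ (Order.max y B)).
  - by rewrite le_max lexx.
  - by apply: large; rewrite // le_max lexx orbT.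
  move=> w yw; apply/negP => /rootp; apply/negP/zmax.
  exact: lt_le_trans yw.
have Fge0 v : 0 <= (F v).[z] by apply: poly_ge0_limit => y /Fpos.
pose f v := (F v).[z].
have lvl_neq v i : lvl v = i.+1 -> v != r by move=> lv; rewrite -(rooted_lvl0 rt) lv.
have Ppos (f' : 'I_n -> R) (i : 'I_m) : (forall u, lvl u = i.+1 -> 0 < f' u) -> 0 < P f' i.
  by move=> h; apply: prodr_gt0 => u; rewrite inE => /eqP/h.
have fpos v : v != r -> 0 < f v.
  elim/downward: v => v IH vr.
  rewrite lt_neqAle Fge0 andbT; apply/eqP => fv.
  have lv0 : lvl v != 0%N by rewrite (rooted_lvl0 rt).
  have lvm : ((lvl v).-1 < m)%N by have := rooted_lvl_le rt v; lia.
  pose i := Ordinal lvm.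
  have vi : v \in block lvl i by rewrite inE /= prednK // lt0n.
  have Wi : 0 < W f i.
    apply: prodr_gt0 => u ui; apply: prodr_gt0 => j uj; apply: Ppos => w lw.
    apply: IH; last exact: lvl_neq lw.
    by have := lvl_block ui uj; rewrite lw /=; clear; lia.
  (* Otherwise the equation of up i has a pole at z and is negative just above z. *)
  have : 0 <= (('X - (a * (cdeg up r (up i))%:R)%:P) * P F i - bk%:P * W F i).[z].
    apply: poly_ge0_limit => y zy.
    pose fy v := (F v).[y].
    have fyp u : 0 < fy u by apply: Fpos.
    have Pyp j : 0 < P fy j by apply: prodr_gt0.
    have Wyp j : 0 < W fy j by apply: prodr_gt0 => u _; apply: prodr_gt0.
    have rp j : 0 < rest fy (up i) j by apply: prodr_gt0.
    rewrite !hornerE Pev Wev -/fy.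
    rewrite -(pmulr_lgt0 _ (rp i)).
    apply: lt_le_trans (fyp (up i)) _; rewrite {1}/fy step_ev // -/fy.
    rewrite (Qrest _ (eqxx _)) (bigD1 i) //=.
    have S0 : 0 <= \sum_(j | (up j == up i) && (j != i)) bk * W fy j * rest fy (up i) j.
      by apply: sumr_ge0 => j _; rewrite !mulr_ge0 // ltW.
    by move: S0; set S := \sum_(j | _) _ => S0; lra.
  rewrite !hornerE Pev Wev -/f {1}/P (bigD1 v) //= -fv mul0r mulr0 sub0r oppr_ge0.
  by rewrite leNgt mulr_gt0.
have fr : f r = 0.
  have : p.[z] = 0 by apply/rootP.
  rewrite pE => /eqP/prodf_eq0[v _ /eqP fv].
  by have [<-//|/fpos] := eqVneq v r; rewrite /f fv ltxx.
have fP i : 0 < P f i by apply: Ppos => u /lvl_neq/fpos.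
have fQ v : 0 < Q f v by apply: prodr_gt0.
exists z, (fun v => f v / Q f v), (fun i => bk * W f i / P f i); split.
- by rewrite fr mul0r.
- by move=> v vr; rewrite divr_gt0 // fpos.
- by move=> i; rewrite divr_gt0 // mulr_gt0 // prodr_gt0.
- move=> i; rewrite prodf_div -/(P f i) -/(W f i).
  have Wi : 0 < W f i by apply: prodr_gt0.
  by move: (lt0r_neq0 (fP i)) (lt0r_neq0 Wi) => h1 h2; field; rewrite h1 h2.
move=> v; have Qv := lt0r_neq0 (fQ v).
apply: (mulIf Qv); rewrite divfK // mulrBl {1}/f step_ev // -/f; congr (_ - _).
rewrite mulr_suml; apply: eq_bigr => i iv; rewrite (Qrest _ iv) mulrA.
by rewrite divfK // lt0r_neq0.
Qed.
End Perron.
End RootedTrees.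

Lemma exists_root_gt0 (R : rcfType) k (c : R) : (0 < k)%N -> 0 < c ->
  exists2 x, 0 < x & x ^+ k = c.
Proof.
move=> k0 c0.
have c1 : 0 <= 1 + c by rewrite addr_ge0 // ltW.
have := @poly_ivt R ('X^k - c%:P) 0 (1 + c) c1.
rewrite !hornerE expr0n eqn0Ngt k0 /= sub0r oppr_le0 ltW //= subr_ge0.
have h : c <= (1 + c) ^+ k.
  apply: le_trans (_ : 1 + c <= _); first by rewrite lerDr.
  by rewrite ler_eXnr // lerDl ltW.
rewrite h => /(_ isT) [x /andP[x0 _] /rootP]; rewrite !hornerE => /eqP.
rewrite subr_eq0 => /eqP xc; exists x => //.
rewrite lt_neqAle x0 andbT eq_sym; apply: contraTneq c0 => x00.
by rewrite -xc x00 expr0n eqn0Ngt k0 ltxx.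
Qed.

(** * From the recursion to a positive eigenvector *)

Section RootedGraph.
Variables (n m K : nat) (lvl : 'I_n -> nat) (up : 'I_m -> 'I_n) (r : 'I_n).
Hypothesis rt : rooted K lvl up r.

Lemma mem_redge i v : (v \in redge lvl up i) = (up i == v) || (lvl v == i.+1).
Proof. by rewrite !inE eq_sym. Qed.

Lemma up_notin_block i : up i \notin block lvl i.
Proof. by rewrite inE; have := rooted_up rt i; lia. Qed.

Lemma prod_redge (S : comPzRingType) (x : 'I_n -> S) i :
  \prod_(u in redge lvl up i) x u = x (up i) * \prod_(u in block lvl i) x u.
Proof. by rewrite big_setU1 // up_notin_block. Qed.

Lemma rgraph_uniform : uniform K.+1 (rgraph lvl up).
Proof.
move=> e /imsetP[i _ ->]; rewrite cardsU1 up_notin_block.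
by rewrite (rooted_block rt).
Qed.

Lemma lvl_pred_lt v : v != r -> ((lvl v).-1 < m)%N.
Proof. by rewrite -(rooted_lvl0 rt) => h; have := rooted_lvl_le rt v; lia. Qed.

Definition own v (vr : v != r) : 'I_m := Ordinal (lvl_pred_lt vr).

Lemma ownE v (vr : v != r) (i : 'I_m) : (lvl v == i.+1) = (i == own vr).
Proof.
have lv : lvl v != 0%N by rewrite (rooted_lvl0 rt).
apply/eqP/eqP => [h|->]; first by apply: val_inj; rewrite /= h.
by rewrite /= prednK // lt0n.
Qed.

Lemma mem_own v (vr : v != r) : v \in block lvl (own vr).
Proof. by rewrite inE (ownE vr). Qed.

Lemma lvl_root (i : 'I_m) : (lvl r == i.+1) = false.
Proof. by have := rooted_lvl0 rt r; rewrite eqxx => /eqP->. Qed.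

Lemma up_neq_own v (vr : v != r) (i : 'I_m) : up i == v -> i != own vr.
Proof.
move=> /eqP uv; apply: contraTneq (mem_own vr) => <-.
by rewrite -uv up_notin_block.
Qed.

Lemma sum_redge_root (V : nmodType) (F : 'I_m -> V) :
  \sum_(i | r \in redge lvl up i) F i = \sum_(i | up i == r) F i.
Proof. by apply: eq_bigl => i; rewrite mem_redge lvl_root orbF. Qed.

Lemma sum_redge_own (V : nmodType) (F : 'I_m -> V) v (vr : v != r) :
  \sum_(i | v \in redge lvl up i) F i = F (own vr) + \sum_(i | up i == v) F i.
Proof.
rewrite (bigD1 (own vr)) /=; last by rewrite mem_redge (ownE vr) eqxx orbT.
congr (_ + _); apply: eq_bigl => i; rewrite mem_redge (ownE vr).
have [uv|] := boolP (up i == v); first by rewrite (up_neq_own vr uv).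
by rewrite /= andbN.
Qed.

Hypothesis K0 : (0 < K)%N.

Lemma redge_inj : injective (redge lvl up).
Proof.
move=> i j eij; apply: val_inj.
have sub k l : redge lvl up k = redge lvl up l -> (k <= l)%N.
  move=> E; have /card_gt0P[u] : (0 < #|block lvl k|)%N by rewrite (rooted_block rt).
  rewrite inE => /eqP lu; have : u \in redge lvl up l by rewrite -E mem_redge lu eqxx orbT.
  rewrite mem_redge lu => /orP[/eqP ul|/eqP[->]//].
  by have := rooted_up rt l; rewrite ul lu; lia.
by apply/eqP; rewrite eqn_leq !sub.
Qed.

Lemma sum_rgraph (V : nmodType) (p : pred {set 'I_n}) (F : {set 'I_n} -> V) :
  \sum_(e in rgraph lvl up | p e) F e = \sum_(i | p (redge lvl up i)) F (redge lvl up i).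
Proof.
rewrite big_mkcondr big_imset /=; last by move=> i j _ _; apply: redge_inj.
by rewrite -big_mkcond.
Qed.

Lemma deg_rgraph v : deg (rgraph lvl up) v = cdeg up r v.
Proof.
rewrite /deg -sum1_card.
under eq_bigl do rewrite inE.
rewrite (@sum_rgraph nat) /cdeg -[in RHS]sum1_card.
under [in RHS]eq_bigl do rewrite inE.
have [->|vr] := eqVneq v r; first exact: (@sum_redge_root nat).
exact: (@sum_redge_own nat).
Qed.

Section Eigenvector.
Variables (R : rcfType) (a lam : R) (g : 'I_n -> R) (bb : 'I_m -> R).
Hypotheses (a_lt1 : a < 1) (gr : g r = 0) (g_gt0 : forall v, v != r -> 0 < g v).
Hypothesis bb_gt0 : forall i, 0 < bb i.
Hypothesis bbE : forall i, bb i * \prod_(u in block lvl i) g u = (1 - a) ^+ K.+1.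
Hypothesis gE : forall v, g v = lam - a * (cdeg up r v)%:R - \sum_(i | up i == v) bb i.

(** The powers y = x ^+ K.+1 are linked linearly along each edge, so y is propagated from the value
    1 at r, and x is recovered by taking roots. *)
Lemma perron_vector : exists x : 'I_n -> R, [/\ forall v, 0 < x v,
   eigeq (rgraph lvl up) K a lam x &
   forall i v, v \in block lvl i -> x v ^+ K.+1 = x (up i) ^+ K.+1 * (bb i / g v)].
Proof.
pose step v (y : 'I_n -> R) :=
  if [pick i : 'I_m | v \in block lvl i] is Some i then y (up i) * (bb i / g v) else 1.
have [y yE] : exists y, forall v, y v = step v y.
  apply: (@measure_rec _ R lvl 1) => v f h fh; rewrite /step.
  case: pickP => // i; rewrite inE => /eqP lv; rewrite fh //.
  by have := rooted_up rt i; lia.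
have ynr i v : v \in block lvl i -> y v = y (up i) * (bb i / g v).
  move=> vi; rewrite yE /step; case: pickP => [j vj|/(_ i)]; last by rewrite vi.
  suff -> : j = i by [].
  by apply: val_inj; move: vi vj; rewrite !inE => /eqP-> /eqP[].
have blk (i : 'I_m) v : v \in block lvl i -> v != r.
  by move=> vi; apply: contraTneq vi => ->; rewrite inE lvl_root.
have y0 v : 0 < y v.
  have [k] := ubnP (lvl v); elim: k v => // k IH v vk.
  have [vr|vr] := eqVneq v r.
    rewrite yE /step; case: pickP => // i /blk; by rewrite vr eqxx.
  rewrite (ynr _ _ (mem_own vr)) mulr_gt0 // ?divr_gt0 ?g_gt0 //.
  apply: IH; have /= := rooted_up rt (own vr).
  by have : lvl v != 0%N by [rewrite (rooted_lvl0 rt)]; lia.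
have [x xP] : exists x : 'I_n -> R, forall v, 0 < x v /\ x v ^+ K.+1 = y v.
  apply: (@fin_all_exists _ (fun=> R) (fun v x => 0 < x /\ x ^+ K.+1 = y v)) => v.
  by have [x x0 xy] := exists_root_gt0 (ltn0Sn K) (y0 v); exists x.
have x0 v : 0 < x v by have [] := xP v.
have xy v : x v ^+ K.+1 = y v by have [] := xP v.
have b0 : 0 < 1 - a by rewrite subr_gt0.
(* Compared after raising to the power K + 1, where the two sides agree precisely by [bbE]. *)
have edgeE i : (1 - a) * \prod_(u in redge lvl up i) x u = y (up i) * bb i.
  apply/eqP; rewrite -(eqrXn2 (ltn0Sn K)); last 2 first.
  - by apply: mulr_ge0; [exact: ltW | apply: prodr_ge0 => u _; exact: ltW].
  - by apply: mulr_ge0; apply: ltW.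
  rewrite exprMn -prodrXl (eq_bigr y) // prod_redge (eq_bigr _ (ynr i)).
  rewrite big_split prodr_const (rooted_block rt) /= big_split prodr_const prodfV /=.
  rewrite (rooted_block rt) -(bbE i) exprMn !exprS.
  have : \prod_(u in block lvl i) g u != 0.
    by apply/lt0r_neq0/prodr_gt0 => u /blk; apply: g_gt0.
  by move: (\prod_(u in _) g u) => p p0; apply/eqP; field.
exists x; split=> //; last by move=> i v vi; rewrite !xy; apply: ynr.
apply/eigeq_mul => [v|v]; first exact: lt0r_neq0.
rewrite xy deg_rgraph sum_rgraph mulr_sumr.
under eq_bigr do rewrite edgeE.
have sumE v' : \sum_(i | up i == v') y (up i) * bb i = y v' * \sum_(i | up i == v') bb i.
  by rewrite mulr_sumr; apply: eq_bigr => i /eqP->.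
have [->|vr] := eqVneq v r.
  rewrite sum_redge_root sumE; have /eqP := gE r.
  by rewrite gr eq_sym !subr_eq add0r => /eqP->; ring.
rewrite (sum_redge_own _ vr) sumE.
rewrite -{1}(divfK (lt0r_neq0 (g_gt0 vr)) (bb _)) mulrA -(ynr _ _ (mem_own vr)).
by rewrite gE; ring.
Qed.
End Eigenvector.
End RootedGraph.

(** * Exploration of a hypertree from a chosen root *)

Section HypertreeExploration.
Variable n : nat.
Implicit Types (G : hgraph n) (u v w : 'I_n) (e : {set 'I_n}) (U : {set 'I_n}).

(** Structural form of the incidence clauses of [hpath] and [hcycle], with distinctness left out. *)
Fixpoint chain u (vs : seq 'I_n) (es : seq {set 'I_n}) : bool :=
  match vs, es with
  | v :: vs', e :: es' => [&& u \in e, v \in e & chain v vs' es']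
  | [::], [::] => true
  | _, _ => false
  end.

Lemma chainP v0 u vs es : chain u vs es <->
  size vs = size es /\ (forall i, (i < size es)%N ->
    nth v0 (u :: vs) i \in nth set0 es i /\ nth v0 vs i \in nth set0 es i).
Proof.
elim: vs u es => [|v vs IH] u [|e es] /=; split=> //; try by case.
  move=> /and3P[ue ve /IH[-> h]]; split=> // -[|i] //=; exact: h.
move=> [[sz] h]; have [ue ve] := h 0%N isT; rewrite /= in ue ve.
by rewrite ue ve; apply/IH; split=> // i; apply: (h i.+1).
Qed.

Lemma chain_rcons u vs es v e :
  chain u (rcons vs v) (rcons es e) = [&& chain u vs es, last u vs \in e & v \in e].
Proof.
elim: vs u es => [|w vs IH] u [|e' es] //=.
- by rewrite andbT.
- by case: es => [|? ?]; rewrite ?andbF //=.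
- by case: vs {IH} => [|? ?]; rewrite ?andbF.
by rewrite IH !andbA.
Qed.

Lemma chain_leave U u vs es : chain u vs es -> u \in U -> last u vs \notin U ->
  exists e v w, [/\ e \in es, v \in e, v \in U, w \in e & w \notin U].
Proof.
elim: vs u es => [|v vs IH] u [|e es] //=; first by move=> _ ->.
move=> /and3P[ue ve ch] uU lU; have [vU|vU] := boolP (v \in U).
  have [e' [x [y [e'es h1 h2 h3 h4]]]] := IH _ _ ch vU lU.
  by exists e', x, y; split=> //; rewrite inE e'es orbT.
by exists e, u, v; split=> //; rewrite mem_head.
Qed.

(** Indexed by nat so that the numbering can be extended one edge at a time. *)
Definition nedge (lvl : 'I_n -> nat) (up : nat -> 'I_n) i : {set 'I_n} :=
  up i |: [set v | lvl v == i.+1].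

Definition linked (E : seq {set 'I_n}) U u v := exists vs es,
  [/\ chain u vs es, uniq (u :: vs), uniq es & last u vs = v] /\
  {subset es <= E} /\ {subset vs <= U}.

Variables (G : hgraph n) (K m : nat) (r : 'I_n).
Hypotheses (K0 : (0 < K)%N) (unif : uniform K.+1 G) (cardG : #|G| = m).
Hypotheses (conn : hconnected G) (acyc : ~ exists v0 vs es, hcycle G v0 vs es).

Let visited (lvl : 'I_n -> nat) j : {set 'I_n} := [set v | (lvl v <= j)%N].
Let used lvl up j := [seq nedge lvl up i | i <- iota 0 j].

Let explored j (lvl : 'I_n -> nat) (up : nat -> 'I_n) :=
  [/\ forall v, (lvl v == 0%N) = (v == r),
      forall v, (lvl v <= j)%N \/ lvl v = m.+1,
      forall i, (i < j)%N -> #|[set v | lvl v == i.+1]| = K /\ (lvl (up i) <= i)%N,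
      {subset used lvl up j <= G} &
      forall u v, u \in visited lvl j -> v \in visited lvl j ->
        linked (used lvl up j) (visited lvl j) u v].

Let conn_chain u v : exists vs es, [/\ chain u vs es, {subset es <= G} & last u vs = v].
Proof.
have [vs [es [[sz _ _ /allP sub h] lst]]] := conn u v.
by exists vs, es; split=> //; apply/(chainP u).
Qed.

(** Otherwise the path of used edges from v to u, completed by e, is a cycle. *)
Let linked_unused lvl up j e u v : explored j lvl up -> e \in G ->
  e \notin used lvl up j -> u \in e -> v \in e ->
  u \in visited lvl j -> v \in visited lvl j -> u = v.
Proof.
move=> [_ _ _ subG lnk] eG eu ue ve uU vU.
have [vs [es [[ch un une lst] [sub _]]]] := lnk v u vU uU.
apply/eqP; apply/negPn/negP => uv; apply: acyc.
exists v, (rcons vs v), (rcons es e).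
have [sz _] := (chainP v v vs es).1 ch.
have ch' : chain v (rcons vs v) (rcons es e) by rewrite chain_rcons ch lst ue ve.
have [sz' h] := (chainP v _ _ _).1 ch'.
split=> //.
- split=> //; rewrite size_rcons -sz; case: vs lst {un ch sz ch' sz' h} => //= vu.
  by rewrite vu eqxx in uv.
- by rewrite size_rcons -sz /= -cats1 take_size_cat.
- by rewrite last_rcons.
split.
  by rewrite rcons_uniq une andbT; apply: contra eu; apply: sub.
rewrite all_rcons; apply/andP; split; first exact: eG.
by apply/allP => e' /sub; apply: subG.
Qed.

Let used_visited lvl up j e v : explored j lvl up ->
  e \in used lvl up j -> v \in e -> v \in visited lvl j.
Proof.
move=> [_ _ blk _ _] /mapP[i]; rewrite mem_iota add0n /= => ij ->.
have [_ upi] := blk i ij.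
by rewrite !inE => /orP[/eqP->|/eqP->//]; lia.
Qed.

Let explore_step j lvl up : explored j lvl up -> (j < m)%N ->
  exists lvl' up', explored j.+1 lvl' up'.
Proof.
move=> ex jm; have [lvl0 lvlj blk subG lnk] := ex.
set U := visited lvl j in lnk; set E := used lvl up j in subG lnk.
have rU : r \in U by rewrite inE; have := lvl0 r; rewrite eqxx => /eqP->.
have [e0 e0G e0E] : exists2 e, e \in G & e \notin E.
  have : ~~ (G \subset [set e in E]).
    apply/negP => /subset_leq_card; rewrite cardG cardsE.
    by move=> /leq_trans /(_ (card_size _)); rewrite size_map size_iota leqNgt jm.
  by case/subsetPn => e eG; rewrite inE => eE; exists e.
have [w we wU] : exists2 w, w \in e0 & w \notin U.
  have /card_gt1P[u [v [ue ve uv]]] : (1 < #|e0|)%N by rewrite (unif e0G).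
  have [uU|] := boolP (u \in U); last by exists u.
  have [vU|] := boolP (v \in U); last by exists v.
  by rewrite (linked_unused ex e0G e0E ue ve uU vU) eqxx in uv.
have [e [p [q [eG pe pU qe qU]]]] : exists e p q,
    [/\ e \in G, p \in e, p \in U, q \in e & q \notin U].
  have [vs [es [ch sub lst]]] := conn_chain r w.
  have lU : last r vs \notin U by rewrite lst.
  have [e [p [q [ees h1 h2 h3 h4]]]] := chain_leave ch rU lU.
  by exists e, p, q; split=> //; apply: sub.
have eE : e \notin E by apply: contra qU => /used_visited; apply.
have eU v : v \in e -> v \in U -> v = p.
  by move=> ve vU; apply: (linked_unused ex eG eE).
pose lvl' v := if (v \in e) && (v \notin U) then j.+1 else lvl v.
pose up' i := if i == j then p else up i.
have notU v : v \notin U -> lvl v = m.+1.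
  by rewrite inE; case: (lvlj v) => // ->.
have lvl'E v i : (i <= j)%N -> (lvl' v == i) = (lvl v == i).
  rewrite /lvl' => ij; case: ifP => // /andP[_ /notU->].
  by rewrite (gtn_eqF (leq_ltn_trans ij (ltnSn j))) (gtn_eqF (leq_ltn_trans ij (leqW jm))).
have blkj : [set v | lvl' v == j.+1] = e :\ p.
  apply/setP => v; rewrite !inE /lvl'; case: ifP => [/andP[ve vU]|h].
    by rewrite eqxx ve andbT; apply/esym; apply: contraNneq vU => ->.
  apply/eqP/andP => [lv|[vp ve]].
    by case: (lvlj v) => lv'; move: lv' jm; rewrite lv; clear; lia.
  move: h; rewrite ve /= => /negbFE /(eU _ ve) vE.
  by rewrite vE eqxx in vp.
have nedgej : nedge lvl' up' j = e.
  by rewrite /nedge blkj /up' eqxx setD1K.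
have nedgei i : (i < j)%N -> nedge lvl' up' i = nedge lvl up i.
  move=> ij; rewrite /nedge /up' ltn_eqF //; congr (_ |: _).
  by apply/setP => v; rewrite !inE lvl'E.
have usedS e' : e' \in used lvl' up' j.+1 = (e' == e) || (e' \in E).
  rewrite /used -addn1 iotaD map_cat mem_cat orbC /= add0n inE nedgej; congr (_ || _).
  suff -> : [seq nedge lvl' up' i | i <- iota 0 j] = E by [].
  by apply/eq_in_map => i; rewrite mem_iota => /= ij; apply: nedgei.
have visS v : v \in visited lvl' j.+1 = (v \in U) || (v \in e).
  rewrite [LHS]inE /lvl'; case: ifP => [/andP[-> _]|h]; first by rewrite leqnn orbT.
  have [vU|vU] := boolP (v \in U); first by rewrite inE in vU; rewrite leqW.
  move: h; rewrite vU andbT => -> /=; rewrite (notU _ vU).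
  by apply/negbTE; rewrite -ltnNge !ltnS.
have pU' : p \in visited lvl' j.+1 by rewrite visS pU.
have subE : {subset E <= used lvl' up' j.+1} by move=> e'; rewrite usedS => ->; rewrite orbT.
have subU : {subset U <= visited lvl' j.+1} by move=> v; rewrite visS => ->.
exists lvl', up'; split.
- by move=> v; rewrite lvl'E.
- move=> v; rewrite /lvl'; case: ifP => _; first by left.
  by case: (lvlj v); [left; apply: leqW|right].
- move=> i; rewrite ltnS leq_eqVlt => /orP[/eqP->|ij].
    rewrite blkj; split; first by have := cardsD1 p e; rewrite pe (unif eG) => -[].
    rewrite /up' eqxx /lvl' pU andbF; move: pU; by rewrite inE.
  have [c upi] := blk i ij; split.
    by rewrite -c; apply: eq_card => v; rewrite !inE lvl'E.
  rewrite /up' ltn_eqF // /lvl' ifF //.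
  apply/negbTE; rewrite inE negb_and negbK; apply/orP; right.
  exact: leq_trans upi (ltnW ij).
- by move=> e'; rewrite usedS => /orP[/eqP->//|]; apply: subG.
move=> u v; rewrite !visS.
have [uU _|uU /= ue] := boolP (u \in U); have [vU _|vU /= ve] := boolP (v \in U).
- have [vs [es [h [h1 h2]]]] := lnk u v uU vU.
  by exists vs, es; split=> //; split=> [? /h1/subE|? /h2/subU].
- have [vs [es [[ch un une lst] [h1 h2]]]] := lnk u p uU pU.
  exists (rcons vs v), (rcons es e); split; split.
  + by rewrite chain_rcons ch lst pe ve.
  + rewrite -rcons_cons rcons_uniq un andbT inE negb_or.
    by rewrite (contraNneq _ vU) => [|->//]; apply: contra vU; apply: h2.
  + by rewrite rcons_uniq une andbT; apply: contra eE; apply: h1.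
  + by rewrite last_rcons.
  + by move=> e'; rewrite mem_rcons inE usedS => /orP[->//|/h1->]; rewrite orbT.
  by move=> x; rewrite mem_rcons inE => /orP[/eqP->|/h2/subU//]; rewrite visS ve orbT.
- have [vs [es [[ch un une lst] [h1 h2]]]] := lnk p v pU vU.
  exists (p :: vs), (e :: es); split; split.
  + by rewrite /= ue pe.
  + rewrite cons_uniq un andbT inE negb_or (contraNneq _ uU) => [|->//].
    by apply: contra uU; apply: h2.
  + by rewrite /= une andbT; apply: contra eE; apply: h1.
  + by [].
  + by move=> e'; rewrite inE usedS => /orP[->//|/h1->]; rewrite orbT.
  by move=> x; rewrite inE => /orP[/eqP->//|/h2/subU].
have [->|uv] := eqVneq u v; first by exists [::], [::].
exists [:: v], [:: e]; split; split=> //=.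
- by rewrite ue ve.
- by rewrite inE uv.
- by move=> e'; rewrite inE usedS => /eqP->; rewrite eqxx.
by move=> x; rewrite inE => /eqP->; rewrite visS ve orbT.
Qed.

Theorem hypertree_rooted : exists lvl (up : 'I_m -> 'I_n),
  rooted K lvl up r /\ G = rgraph lvl up.
Proof.
have [lvl [up ex]] : exists lvl up, explored m lvl up.
  suff h j : (j <= m)%N -> exists lvl up, explored j lvl up by apply: h.
  elim: j => [_|j IH jm].
    exists (fun v => if v == r then 0%N else m.+1), (fun=> r); split=> //.
    - by move=> v; case: (v =P r).
    - by move=> v; case: (v =P r) => _; [left|right].
    move=> u v; rewrite !inE; case: (u =P r) => // -> _; case: (v =P r) => // -> _.
    by exists [::], [::].
  have [lvl [up ex]] := IH (ltnW jm).
  exact: explore_step ex jm.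
have [lvl0 lvlj blk subG lnk] := ex.
have rU : r \in visited lvl m by rewrite inE; have := lvl0 r; rewrite eqxx => /eqP->.
have inj : {in iota 0 m &, injective (nedge lvl up)}.
  have le i l : (i < m)%N -> (l < m)%N -> nedge lvl up i = nedge lvl up l -> (i <= l)%N.
    move=> im lm E; have [c _] := blk i im; have [_ upl] := blk l lm.
    have /card_gt0P[u] : (0 < #|[set v | lvl v == i.+1]|)%N by rewrite c.
    rewrite inE => /eqP lu; have : u \in nedge lvl up l by rewrite -E !inE lu eqxx orbT.
    by rewrite !inE lu => /orP[/eqP uE|]; [rewrite -uE lu in upl|]; lia.
  move=> i l; rewrite !mem_iota => /= im lm E.
  by apply/eqP; rewrite eqn_leq (le i l) // (le l i).
have GE : G = [set e in used lvl up m].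
  apply/esym/eqP; rewrite eqEcard; apply/andP; split.
    by apply/subsetP => e; rewrite inE; apply: subG.
  have us : uniq (used lvl up m) by rewrite map_inj_in_uniq ?iota_uniq.
  have -> : #|[set e in used lvl up m]| = size (used lvl up m).
    by rewrite cardsE; apply/card_uniqP.
  by rewrite cardG size_map size_iota.
have allU v : v \in visited lvl m.
  apply/negPn/negP => vU.
  have [vs [es [ch sub lst]]] := conn_chain r v.
  have [] := chain_leave ch rU; first by rewrite lst.
  move=> e [p [q [ees _ _ qe /negP]]]; apply; apply: used_visited ex _ qe.
  by have := sub _ ees; rewrite GE inE.
exists lvl, (fun i : 'I_m => up i); split.
  split=> //.
  - by move=> v; have := allU v; rewrite inE.
  - by move=> i; have [] := blk i (ltn_ord i).
  by move=> i; have [] := blk i (ltn_ord i).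
apply/setP => e; rewrite GE inE; apply/mapP/imsetP => [[i]|[i _ ->]].
  by rewrite mem_iota /= add0n => im ->; exists (Ordinal im).
by exists (val i); rewrite ?mem_iota /=.
Qed.
End HypertreeExploration.

(** * Stars of loose paths and their weights *)

Section Starlike.
Variables (n m K : nat) (lvl : 'I_n -> nat) (up : 'I_m -> 'I_n) (r : 'I_n).
Hypothesis rt : rooted K lvl up r.

(** Levels name blocks, so equal nonzero levels mean that both edges hang below the same edge. Every
    edge thus has at most one edge below it, and the branches at r are loose paths. *)
Definition starlike := forall i j : 'I_m,
  lvl (up i) = lvl (up j) -> lvl (up i) != 0%N -> i = j.

Definition root_edges : {set 'I_m} := [set i | up i == r].

(** Number of edges in the branch that begins with i; in a star, the length of the rest of its
    leg. *)
Definition is_height (h : 'I_m -> nat) :=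
  forall i, h i = (\sum_(j | lvl (up j) == i.+1) h j).+1.

Lemma exists_height : exists h, is_height h.
Proof.
pose step (i : 'I_m) (h : 'I_m -> nat) := (\sum_(j | lvl (up j) == i.+1) h j).+1.
apply: (@measure_rec _ nat (fun i : 'I_m => m - i)%N 0%N step) => i f g fg.
congr _.+1; apply: eq_bigr => j /eqP lj; apply: fg.
by have := rooted_up rt j; have := ltn_ord j; lia.
Qed.

(** Summing the defining equation over all edges gives m plus the heights of the edges not at r,
    each counted below its parent; these cancel. *)
Lemma sum_height h : is_height h -> (\sum_(i in root_edges) h i = m)%N.
Proof.
move=> hh.
have E : (\sum_i h i = m + \sum_(i | i \notin root_edges) h i)%N.
  under eq_bigr do rewrite hh -add1n.
  rewrite big_split /= sum_nat_const card_ord muln1; congr addn.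
  under eq_bigr do rewrite big_mkcond.
  rewrite exchange_big [RHS]big_mkcond; apply: eq_bigr => j _ /=.
  rewrite -big_mkcond inE; case: eqVneq => [->|ur] /=.
    by rewrite big1 // => i; rewrite (lvl_root rt).
  by rewrite (big_pred1 (own rt ur)) // => i; rewrite /= (ownE rt ur).
have := E; rewrite (bigID (mem root_edges)) /=.
by move/eqP; rewrite eqn_add2r => /eqP.
Qed.

Section Recursion.
Variables (R : realFieldType) (a lam : R) (g : 'I_n -> R) (bb : 'I_m -> R) (h : 'I_m -> nat).
Hypotheses (a_ge0 : 0 <= a) (a_lt1 : a < 1) (K0 : (0 < K)%N) (m0 : (0 < m)%N).
Hypotheses (gr : g r = 0) (g_gt0 : forall v, v != r -> 0 < g v).
Hypothesis bb_gt0 : forall i, 0 < bb i.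
Hypothesis bbE : forall i, bb i * \prod_(u in block lvl i) g u = (1 - a) ^+ K.+1.
Hypothesis gE : forall v, g v = lam - a * (cdeg up r v)%:R - \sum_(i | up i == v) bb i.
Hypotheses (star : starlike) (hh : is_height h).

Let D := lam - a.
Let c := (1 - a) ^+ K.+1 / D ^+ K.-1.

Lemma recursion_gap_gt0 : 0 < lam - a.
Proof.
have [u] : exists u, u \in block lvl (Ordinal m0).
  by apply/card_gt0P; rewrite (rooted_block rt).
rewrite inE => /eqP lu; have ur : u != r by rewrite -(rooted_lvl0 rt) lu.
apply: lt_le_trans (g_gt0 ur) _; rewrite gE /cdeg ur.
apply: le_trans (_ : lam - a * (1 + #|[set i | up i == u]|)%:R <= _).
  by rewrite gerBl sumr_ge0 // => i _; apply: ltW.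
rewrite lerD2l lerN2; apply: ler_peMr => //.
by rewrite ler1n.
Qed.

Let g_leaf u : u != r -> (forall j, up j != u) -> g u = D.
Proof.
move=> ur nj; rewrite gE /cdeg ur big1 => [|j ju]; last by have := nj j; rewrite ju.
rewrite (_ : #|_| = 0%N) ?mulr1 ?subr0 //.
by apply: eq_card0 => j; rewrite inE (negbTE (nj j)).
Qed.

Let up_block (i j : 'I_m) u : u \in block lvl i -> up j = u -> lvl (up j) = i.+1.
Proof. by rewrite inE => /eqP lu ->. Qed.

Let block_neq (i : 'I_m) u : u \in block lvl i -> u != r.
Proof. by rewrite inE -(rooted_lvl0 rt) => /eqP->. Qed.

Lemma starlike_child (i j : 'I_m) : lvl (up j) = i.+1 ->
  g (up j) = D - (a + bb j) /\ h i = (h j).+1.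
Proof.
move=> lj; have uniqj j' : lvl (up j') = i.+1 -> j' = j.
  by move=> lj'; apply: star; rewrite ?lj ?lj'.
have ui : up j \in block lvl i by rewrite inE lj.
split; last first.
  by rewrite hh (big_pred1 j) // => j' /=; apply/eqP/eqP => [/uniqj//|->//].
rewrite gE /cdeg (block_neq ui) (big_pred1 j) => [|j'] /=; last first.
  by apply/eqP/eqP => [e|->//]; apply: uniqj; rewrite e.
rewrite (_ : #|_| = 1%N); first by rewrite /D (_ : (1 + 1)%N%:R = 1 + 1 :> R) ?natrD //; ring.
apply/eqP/cards1P; exists j; apply/setP => j'; rewrite !inE.
by apply/eqP/eqP => [e|->//]; apply: uniqj; rewrite e.
Qed.

(** In a block every vertex has g = D, except the one where the leg continues, which has g = D - w.
    Hence [bbE] reads bb * D^(K-1) * (D - w) = (1-a)^(K+1), the recursion of [legw]; the last edge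
    of a leg is the case w = 0. *)
Lemma starlike_branch i :
  leg_ok a c D (h i) /\ a + bb i = legw a c D (h i).
Proof.
have D0 : 0 < D := recursion_gap_gt0.
have [k] := ubnP (m - i); elim: k i => // k IH i ik.
have cE : c * D ^+ K.-1 = (1 - a) ^+ K.+1 by rewrite divfK // expf_neq0 // gt_eqF.
case: (pickP (fun j => lvl (up j) == i.+1)) => [j /eqP lj|nj]; last first.
  have -> : h i = 1%N by rewrite hh big_pred0.
  split; first by case.
  rewrite /= subr0; congr (_ + _); apply: (mulIf (lt0r_neq0 D0)).
  rewrite divfK ?lt0r_neq0 //.
  have := bbE i; rewrite (eq_bigr (fun=> D)) => [|u ui]; last first.
    apply: g_leaf; first exact: block_neq ui.
    by move=> j; apply/eqP => /(up_block ui) /eqP; rewrite nj.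
  rewrite prodr_const (rooted_block rt) -cE -[in bb i * _](prednK K0) exprS mulrA.
  by move/(mulIf (expf_neq0 _ (lt0r_neq0 D0))).
have uniqj j' : lvl (up j') = i.+1 -> j' = j.
  by move=> lj'; apply: star; rewrite ?lj ?lj'.
have [gu ->] := starlike_child lj.
have ji : (m - j < k)%N.
  by have := rooted_up rt j; have := ltn_ord j; rewrite lj; lia.
have [ok wj] := IH j ji.
have ui : up j \in block lvl i by rewrite inE lj.
rewrite wj in gu.
have gu0 := g_gt0 (block_neq ui).
split.
  move=> l; rewrite ltnS leq_eqVlt => /orP[/eqP->|]; last exact: ok.
  by rewrite -subr_gt0 -gu.
rewrite /= -gu; congr (_ + _); apply: (mulIf (lt0r_neq0 gu0)).
rewrite divfK ?lt0r_neq0 //.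
have := bbE i; rewrite (big_setD1 (up j)) //= (eq_bigr (fun=> D)) => [|u]; last first.
  rewrite !inE => /andP[uj ui']; have {}ui' : u \in block lvl i by rewrite inE.
  apply: g_leaf; first exact: block_neq ui'.
  move=> j'; apply: contraNneq uj => e; rewrite -e.
  by rewrite (uniqj j') // (up_block ui' e).
have cb : #|block lvl i :\ up j| = K.-1.
  by have := cardsD1 (up j) (block lvl i); rewrite ui (rooted_block rt) => ->.
rewrite prodr_const cb -cE mulrA.
by move/(mulIf (expf_neq0 _ (lt0r_neq0 D0))).
Qed.

Lemma starlike_sum : \sum_(i in root_edges) legw a c D (h i) = D + a.
Proof.
under eq_bigr do rewrite -(starlike_branch _).2.
rewrite big_split /= sumr_const /D subrK.
have := gE r; rewrite gr /cdeg eqxx add0n.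
have -> : \sum_(i | up i == r) bb i = \sum_(i in root_edges) bb i.
  by apply: eq_bigl => i; rewrite inE.
by rewrite mulr_natr => /eqP; rewrite eq_sym !subr_eq add0r addrC => /eqP.
Qed.
Section TwoLegs.
Variable x : 'I_n -> R.
Hypotheses (x_gt0 : forall v, 0 < x v) (xr : forall v, x v <= x r).
Hypothesis xE : forall i v, v \in block lvl i ->
  x v ^+ K.+1 = x (up i) ^+ K.+1 * (bb i / g v).

(* With two legs, every splitting of the path has the same spectral radius; it is the
   maximality of the eigenvector at the root that puts the root in the middle. *)
Lemma two_legs_balanced : #|root_edges| = 2 -> balanced root_edges h.
Proof.
move=> c2 i l iL lL; rewrite leqNgt; apply/negP => lt.
have il : i != l by apply: contraTneq lt => ->; rewrite -leqNgt.
have LE : root_edges = [set i; l].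
  apply/esym/eqP; rewrite eqEcard c2 cards2 il leqnn andbT.
  by apply/subsetP => j; rewrite in_set2 => /orP[/eqP->|/eqP->].
have := starlike_sum; rewrite LE big_setU1 ?inE //= big_set1 => sumE.
case: (pickP (fun j => lvl (up j) == i.+1)) => [j /eqP lj|nj]; last first.
  by move: lt; rewrite [h i]hh big_pred0.
have [gu hi] := starlike_child lj.
have ui : up j \in block lvl i by rewrite inE lj.
have gu0 := g_gt0 (block_neq ui).
have upi : up i = r by move: iL; rewrite inE => /eqP.
(* Maximality at r, read through [xE]. With [gu] it gives w_i + w_j <= D + a = w_i + w_l, although
   the leg from j is longer than that from l. *)
have bg : bb i <= g (up j).
  rewrite -[leRHS]mul1r -ler_pdivrMr // -(ler_pM2l (exprn_gt0 K.+1 (x_gt0 r))) mulr1.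
  have := xE ui; rewrite upi => <-.
  by rewrite lerXn2r ?nnegrE ?xr // ltW.
have [oki wi] := starlike_branch i; have [okj wj] := starlike_branch j.
have D0 : 0 < D := recursion_gap_gt0.
have c0 : 0 < c by apply: divr_gt0; apply: exprn_gt0; rewrite // subr_gt0.
have : legw a c D (h l) < legw a c D (h j).
  apply: (legw_ltmono a_ge0 c0 D0 oki).
  by move: lt; rewrite hi ltnS => ->; rewrite leqnSn.
move: gu bg wi wj sumE; lra.
Qed.
End TwoLegs.
End Recursion.
End Starlike.

(** * Comparison of two stars with the same numbers of legs and edges *)

Definition leg_coef (R : fieldType) (K : nat) (a lam : R) : R :=
  (1 - a) ^+ K.+1 / (lam - a) ^+ K.-1.

(* [legs_at K a lam A h]: lam is the spectral radius of the star of legs with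
   lengths h i, i in A. *)
Definition legs_at (R : realFieldType) (K : nat) (a lam : R) (I : finType)
    (A : {set I}) (h : I -> nat) : Prop :=
  [/\ 0 < lam - a,
      forall i, i \in A -> leg_ok a (leg_coef K a lam) (lam - a) (h i) &
      \sum_(i in A) legw a (leg_coef K a lam) (lam - a) (h i) = lam].

Section Compare.
Variables (R : realFieldType) (K : nat) (a lamS lamT : R).
Variables (I J : finType) (A : {set I}) (B : {set J}) (h : I -> nat) (l : J -> nat).
Hypotheses (a_ge0 : 0 <= a) (a_lt1 : a < 1).
Hypotheses (hS : legs_at K a lamS A h) (hT : legs_at K a lamT B l).
Hypotheses (cAB : #|A| = #|B|) (A1 : (1 < #|A|)%N) (h_gt0 : forall i, i \in A -> (0 < h i)%N).
Hypotheses (sAB : (\sum_(i in A) h i = \sum_(i in B) l i)%N) (balT : balanced B l).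

Let D := lamS - a.
Let c := leg_coef K a lamS.
Let w := legw a c D.

Let D_gt0 : 0 < D. Proof. by case: hS. Qed.
Let c_gt0 : 0 < c. Proof. by rewrite divr_gt0 ?exprn_gt0 // ?subr_gt0; case: hS. Qed.
Let DaE : D + a = lamS. Proof. by rewrite subrK. Qed.

Let w_gt0 i : i \in A -> 0 < w (h i).
Proof.
have [_ ok _] := hS; move=> iA.
by apply: (@legw_ltmono _ _ _ _ a_ge0 c_gt0 D_gt0 _ 0%N _ (ok i iA)); rewrite h_gt0 /=.
Qed.

(** N is the largest sum of two leg lengths. These two legs weigh at most lamS together and merge
    into an admissible path of N edges. A third leg has positive weight, which makes the bound
    strict. *)
Let pair_bound : exists N, [/\ leg_ok a c D N, w N <= D + a,
  (2 < #|A|)%N -> w N < D + a &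
  forall i j, i \in A -> j \in A -> i != j -> (h i + h j <= N)%N].
Proof.
have /card_gt1P[i0 [j0 [i0A j0A ij0]]] := A1.
pose P (p : I * I) := [&& p.1 \in A, p.2 \in A & p.1 != p.2].
have P0 : P (i0, j0) by rewrite /P /= i0A j0A.
have [[i j] /and3P[/= iA jA ij] pmax] := @arg_maxnP _ _ P (fun p => h p.1 + h p.2)%N P0.
have [_ ok sum] := hS.
have sumE := sum_two w h iA jA ij; rewrite sum in sumE.
have rest0 : 0 <= \sum_(x in A | (x != i) && (x != j)) w (h x).
  by apply: sumr_ge0 => x /andP[/w_gt0/ltW].
have le : w (h i) + w (h j) <= D + a by rewrite DaE sumE lerDl.
have [okN wN] := legw_merge c_gt0 (ok i iA) (ok j jA) le.
exists (h i + h j)%N; split=> //; last first.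
  move=> x y xA yA xy; have := pmax (x, y); rewrite /P /= xA yA xy; exact.
move=> A2; apply: (legw_merge_lt c_gt0 (ok i iA) (ok j jA)).
rewrite -/w DaE sumE ltrDl.
have : (0 < #|A :\ i :\ j|)%N.
  by have := A2; rewrite (cardsD1 i) iA (cardsD1 j) !inE jA eq_sym ij.
case/card_gt0P => x; rewrite !inE => /and3P[xj xi xA].
rewrite (bigD1 x) /=; last by rewrite xA xi xj.
by rewrite ltr_wpDr ?w_gt0 // sumr_ge0 // => y /andP[/andP[/w_gt0/ltW]].
Qed.

Let bal := let m := (\sum_(i in A) h i)%N in
  w (m %/ #|A|)%N *+ (#|A| - m %% #|A|) + w (m %/ #|A|)%N.+1 *+ (m %% #|A|).

Let lamS_le_bal : lamS <= bal.
Proof.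
have [N [okN wN _ hN]] := pair_bound.
have [_ _ <-] := hS; apply: (balance_le _ hN); last exact: ltnW.
by move=> x y; apply: legw_transfer.
Qed.

(** bal sums over the lengths of the balanced star, but with weights at lamS; passing to the smaller
    parameter lamT increases them. *)
Let bal_le : lamT <= lamS -> bal <= lamT.
Proof.
move=> TS; have [DT okT sumT] := hT.
have -> : bal = \sum_(i in B) w (l i).
  by rewrite /bal cAB sAB balanced_sum //; rewrite -cAB ltnW.
rewrite -sumT; apply: ler_sum => j jB.
apply: (legw_param_mono a_ge0 c_gt0 D_gt0 _ _ (okT j jB)).2 => //.
  rewrite /c /leg_coef ler_pM2l ?exprn_gt0 ?subr_gt0 //.
  rewrite lef_pV2 ?posrE ?exprn_gt0 //.
  by apply: lerXn2r; rewrite ?nnegrE; [exact: ltW|exact: ltW|rewrite lerD2r].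
by rewrite /D lerD2r.
Qed.

Lemma legs_compare : lamS <= lamT.
Proof.
rewrite leNgt; apply/negP => TS.
have := le_trans lamS_le_bal (bal_le (ltW TS)).
by rewrite leNgt TS.
Qed.

Lemma legs_compare_eq : lamT <= lamS -> (2 < #|A|)%N -> balanced A h.
Proof.
move=> TS A2; have [N [okN wN wN' hN]] := pair_bound.
have [_ _ sumS] := hS.
apply: (balance_lt (phi := w) _ hN); first by move=> x y; apply: legw_transfer_lt => //; apply: wN'.
  exact: ltnW.
have -> : \sum_(i in A) w (h i) = lamS := sumS.
exact: le_trans (bal_le TS) TS.
Qed.
End Compare.

(** * Moving branches to the root *)

Section Surgery.
Variables (n m K : nat) (lvl : 'I_n -> nat) (up : 'I_m -> 'I_n) (r : 'I_n).
Hypothesis rt : rooted K lvl up r.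

Lemma card_rooted : n = (m * K).+1.
Proof.
have : (\sum_(v : 'I_n) 1 = n)%N by rewrite sum1_card card_ord.
rewrite (bigD1 r) //= => nE; rewrite -[LHS]nE add1n; congr _.+1.
have -> : (m * K = \sum_(i < m) K)%N by rewrite sum_nat_const card_ord.
rewrite (eq_bigr (fun i : 'I_m => \sum_(v in block lvl i) 1)%N); last first.
  by move=> i _; rewrite sum1_card (rooted_block rt).
under [RHS]eq_bigr do rewrite big_mkcond.
rewrite exchange_big [LHS]big_mkcond; apply: eq_bigr => v _ /=; rewrite -big_mkcond.
have [->|vr] /= := eqVneq v r.
  by rewrite big_pred0 // => i; rewrite inE (lvl_root rt).
by rewrite (big_pred1 (own rt vr)) // => i; rewrite /= inE (ownE rt vr).
Qed.

Definition leaf_edges : {set 'I_m} := [set i : 'I_m | [forall j, lvl (up j) != i.+1]].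

(* The edges kept in place when all branches but the first at each edge are moved
   to the root. *)
Definition kept (i : 'I_m) : bool :=
  (up i != r) && [forall j : 'I_m, (j < i)%N ==> (lvl (up j) != lvl (up i))].

Definition moved_up (i : 'I_m) : 'I_n := if kept i then up i else r.

Lemma rooted_moved : rooted K lvl moved_up r.
Proof.
have [h1 h2 h3 h4] := rt; split=> // i; rewrite /moved_up; case: ifP => // _.
by have := h1 r; rewrite eqxx => /eqP->.
Qed.

Lemma kept_inj i j : kept i -> kept j -> lvl (up i) = lvl (up j) -> i = j.
Proof.
move=> /andP[_ /forallP ki] /andP[_ /forallP kj] e.
apply: val_inj; apply/eqP; rewrite eqn_leq; apply/andP.
split; rewrite leqNgt; apply/negP => lt.
  by have := ki j; rewrite lt e eqxx.
by have := kj i; rewrite lt e eqxx.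
Qed.

Lemma starlike_moved : starlike lvl moved_up.
Proof.
have l0 : lvl r = 0%N by have := rooted_lvl0 rt r; rewrite eqxx => /eqP.
move=> i j; rewrite /moved_up.
case: ifP => [ki|_]; last by rewrite l0.
case: ifP => [kj e _|_ ->]; last by rewrite l0.
exact: kept_inj.
Qed.

Lemma exists_kept i : up i != r -> exists2 j, kept j & lvl (up j) = lvl (up i).
Proof.
move=> ur; pose P (j : 'I_m) := lvl (up j) == lvl (up i).
have [j /eqP Pj jmin] := @arg_minnP _ i P (fun j : 'I_m => j : nat) (eqxx _).
exists j => //; apply/andP; split.
  by rewrite -(rooted_lvl0 rt) Pj (rooted_lvl0 rt).
apply/forallP => l; apply/implyP => lj; apply/eqP => e.
by have := jmin l; rewrite /P e Pj eqxx leqNgt lj => /(_ isT).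
Qed.

(** Each edge with something below it keeps exactly one child, so kept edges and leaf edges together
    number m; the edges not kept are the ones at r. *)
Lemma card_root_edges_moved : #|root_edges moved_up r| = #|leaf_edges|.
Proof.
have E : #|[set i | kept i]| = #|~: leaf_edges|.
  rewrite -!sum1_card.
  transitivity (\sum_(i | kept i) \sum_(p : 'I_m | lvl (up i) == p.+1) 1)%N.
    apply: eq_big => [i|i]; first by rewrite inE.
    rewrite inE => /andP[ur _]; rewrite (big_pred1 (own rt ur)) // => p.
    by rewrite /= (ownE rt ur).
  under eq_bigr do rewrite big_mkcond.
  rewrite exchange_big [RHS]big_mkcond; apply: eq_bigr => p _ /=; rewrite -big_mkcondr.
  rewrite !inE negb_forall; case: ifP => [/existsP[j]|/negbT].
    rewrite negbK => /eqP lj; have ur : up j != r by rewrite -(rooted_lvl0 rt) lj.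
    have [i ki li] := exists_kept ur.
    rewrite (big_pred1 i) // => l /=; apply/andP/eqP => [[kl /eqP ll]|->].
      by apply: kept_inj => //; rewrite ll li lj.
    by rewrite ki li lj eqxx.
  rewrite negb_exists => /forallP h; rewrite big_pred0 // => j.
  by have := h j; rewrite negbK => /negbTE->; rewrite andbF.
have -> : root_edges moved_up r = ~: [set i | kept i].
  apply/setP => i; rewrite !inE /moved_up; case: ifP => [/andP[/negbTE-> //]|_].
  by rewrite eqxx.
by apply/eqP; rewrite -(eqn_add2l #|~: leaf_edges|) -{1}E cardsC addnC cardsC.
Qed.

Hypothesis K0 : (0 < K)%N.

Lemma deg_up_ge2 i : up i != r -> (1 < deg (rgraph lvl up) (up i))%N.
Proof.
move=> ur; rewrite (deg_rgraph rt K0) /cdeg ur add1n ltnS.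
by apply/card_gt0P; exists i; rewrite inE.
Qed.

(** Since r has degree at least 2, so has every vertex [up j]. An edge with another one below it
    therefore contains two such vertices, a leaf edge only [up i]. *)
Lemma pendant_redge i : (1 < deg (rgraph lvl up) r)%N ->
  pendant (rgraph lvl up) (redge lvl up i) = (i \in leaf_edges).
Proof.
move=> dr; have dup j : (1 < deg (rgraph lvl up) (up j))%N.
  by have [->//|] := eqVneq (up j) r; apply: deg_up_ge2.
rewrite /pendant imset_f //=; apply/existsP/idP => [[v /and3P[_ _ /forallP h]]|li].
  rewrite inE; apply/forallP => j; apply/eqP => lj.
  have uj : up j \in redge lvl up i by rewrite mem_redge lj eqxx orbT.
  have ui : up i \in redge lvl up i by rewrite mem_redge eqxx.
  have uij : up i != up j.
    apply/eqP => e; have := rooted_up rt i; rewrite e lj; clear; lia.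
  have d1 w : w \in redge lvl up i -> (1 < deg (rgraph lvl up) w)%N -> w = v.
    move=> we dw; apply/eqP; apply: contraLR dw => wv.
    by have := h w; rewrite we wv /= => /eqP->.
  by rewrite (d1 _ ui) // (d1 _ uj) // eqxx in uij.
exists (up i); rewrite mem_redge eqxx dup /=; apply/forallP => v.
rewrite mem_redge; apply/implyP => /orP[/eqP->|/eqP lv]; first by rewrite eqxx.
apply/implyP => _; rewrite (deg_rgraph rt K0) /cdeg.
have -> : v != r by rewrite -(rooted_lvl0 rt) lv.
rewrite (_ : #|_| = 0%N) //; apply: eq_card0 => j; rewrite inE.
apply/eqP => uj; move: li; rewrite inE => /forallP/(_ j).
by rewrite uj lv eqxx.
Qed.

Lemma card_pendant_edges : (1 < deg (rgraph lvl up) r)%N ->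
  #|pendant_edges (rgraph lvl up)| = #|leaf_edges|.
Proof.
move=> dr; rewrite -(card_imset _ (redge_inj rt K0)); apply: eq_card => e.
rewrite inE; apply/idP/imsetP => [pe|[i li ->]]; last by rewrite pendant_redge.
have /imsetP[i _ eE] : e \in rgraph lvl up by case/andP: pe.
by exists i => //; rewrite -pendant_redge // -eE.
Qed.
End Surgery.

(** * Effect of the move on the spectral radius *)

Lemma sum_incidence (V : nmodType) n (G : hgraph n) (F : {set 'I_n} -> 'I_n -> V) :
  \sum_v \sum_(e in G | v \in e) F e v = \sum_(e in G) \sum_(v in e) F e v.
Proof.
under eq_bigr do rewrite big_mkcondr.
by rewrite exchange_big /=; apply: eq_bigr => e _; rewrite -big_mkcond.
Qed.

Lemma sum_deg (R : pzRingType) n (G : hgraph n) (f : 'I_n -> R) :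
  \sum_v (deg G v)%:R * f v = \sum_(e in G) \sum_(v in e) f v.
Proof.
rewrite -(sum_incidence G (fun _ => f)); apply: eq_bigr => v _.
rewrite sumr_const mulr_natl; congr (_ *+ _).
by rewrite /deg; apply: eq_card => e; rewrite inE.
Qed.

Lemma eigeq_sum (R : idomainType) n K (G : hgraph n) (a lam : R) x :
  uniform K.+1 G -> (forall v, x v != 0) -> eigeq G K a lam x ->
  K.+1%:R * (1 - a) * \sum_(e in G) \prod_(u in e) x u
    + a * \sum_v (deg G v)%:R * x v ^+ K.+1 = lam * \sum_v x v ^+ K.+1.
Proof.
move=> unif x0 /(eigeq_mul K G a lam x0) ex.
rewrite [RHS]mulr_sumr -(eq_bigr _ (fun v _ => ex v)) big_split /= addrC; congr (_ + _).
  rewrite -mulr_sumr sum_incidence [_%:R * _]mulrC -mulrA; congr (_ * _).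
  rewrite mulr_sumr; apply: eq_bigr => e eG.
  by rewrite sumr_const (unif e eG) mulr_natl.
by rewrite mulr_sumr; apply: eq_bigr => v _; rewrite mulrA.
Qed.

Section MoveBranches.
Variables (R : realFieldType) (n m K : nat) (lvl : 'I_n -> nat) (up up' : 'I_m -> 'I_n).
Variables (r : 'I_n) (a lam lam' : R) (x x' : 'I_n -> R).
Hypotheses (K0 : (0 < K)%N) (rt : rooted K lvl up r) (rt' : rooted K lvl up' r).
Hypotheses (a_ge0 : 0 <= a) (a_lt1 : a < 1).
Hypotheses (x_gt0 : forall v, 0 < x v) (x'_gt0 : forall v, 0 < x' v).
Hypotheses (ex : eigeq (rgraph lvl up) K a lam x) (ex' : eigeq (rgraph lvl up') K a lam' x').
Hypotheses (xr : forall v, x v <= x r) (mv : forall i, up' i = up i \/ up' i = r).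

Let x_neq0 v : x v != 0. Proof. exact: lt0r_neq0. Qed.

Let up_le i : x (up i) <= x (up' i).
Proof. by case: (mv i) => ->. Qed.

Let sum_graph (u : 'I_m -> 'I_n) : rooted K lvl u r ->
  forall F : {set 'I_n} -> R, \sum_(e in rgraph lvl u) F e = \sum_i F (redge lvl u i).
Proof.
move=> ru F; rewrite -(sum_rgraph ru K0 predT); apply: eq_bigl => e.
by rewrite andbT.
Qed.

Let quad (u : 'I_m -> 'I_n) :=
  K.+1%:R * (1 - a) * \sum_(e in rgraph lvl u) \prod_(v in e) x v
    + a * \sum_v (deg (rgraph lvl u) v)%:R * x v ^+ K.+1.

Let quad_le : quad up <= quad up'.
Proof.
rewrite /quad !sum_deg !sum_graph //; apply: lerD.
  apply: ler_wpM2l; first by rewrite mulr_ge0 // subr_ge0 ltW.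
  apply: ler_sum => i _; rewrite (prod_redge rt) (prod_redge rt').
  by apply: ler_wpM2r => //; apply: prodr_ge0 => v _; apply: ltW.
apply: ler_wpM2l => //; apply: ler_sum => i _.
rewrite (big_setU1 _ (up_notin_block rt i)) (big_setU1 _ (up_notin_block rt' i)) /=.
by rewrite lerD2r lerXn2r ?nnegrE // ltW.
Qed.

Let norm_gt0 : 0 < \sum_v x v ^+ K.+1.
Proof.
rewrite (bigD1 r) //=; apply: ltr_pwDl; first exact: exprn_gt0.
by apply: sumr_ge0 => v _; apply: exprn_ge0; apply: ltW.
Qed.

Let lamE : quad up = lam * \sum_v x v ^+ K.+1.
Proof. exact: eigeq_sum (rgraph_uniform rt) x_neq0 ex. Qed.

Let quad'_le : quad up' <= lam' * \sum_v x v ^+ K.+1.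
Proof.
exact: (rayleigh a_lt1 (rgraph_uniform rt') x'_gt0 (fun v => ltW (x_gt0 v)) ex').
Qed.

Lemma move_le : lam <= lam'.
Proof.
rewrite -(ler_pM2r norm_gt0) -lamE; exact: le_trans quad_le quad'_le.
Qed.

(** Equality in the Rayleigh principle makes x / x' constant on each edge of the new tree, hence
    everywhere. *)
Lemma move_eq_ratio : lam' <= lam -> forall v, x v / x' v = x r / x' r.
Proof.
move=> le; have h : lam' * \sum_v x v ^+ K.+1 <= quad up'.
  by apply: le_trans quad_le; rewrite lamE ler_wpM2r // ltW.
have e := rayleigh_eq a_lt1 (rgraph_uniform rt') x'_gt0 (fun v => ltW (x_gt0 v)) ex' h.
move=> v; have [k] := ubnP (lvl v); elim: k v => // k IH v vk.
have [->//|vr] := eqVneq v r.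
have eG : redge lvl up' (own rt' vr) \in rgraph lvl up' by apply: imset_f.
rewrite (e _ v (up' (own rt' vr)) eG); last 2 first.
- by rewrite mem_redge (ownE rt' vr) eqxx orbT.
- by rewrite mem_redge eqxx.
apply: IH; apply: leq_ltn_trans (rooted_up rt' _) _.
have : lvl v != 0%N by rewrite (rooted_lvl0 rt').
by move: vk; rewrite /=; clear; case: (lvl v).
Qed.

(** x then solves the equations of both trees for the same lam; a branch really moved would add a
    positive term to the equation at r in the new tree alone. *)
Lemma move_eq : lam' <= lam -> forall i, up' i = up i.
Proof.
move=> le; have ratio := move_eq_ratio le.
have lamlam : lam = lam' by apply: le_anti; rewrite move_le.
pose s := x r / x' r.
have s0 : 0 < s by rewrite divr_gt0.
have xE v : x v = s * x' v by rewrite /s -(ratio v) divfK // lt0r_neq0.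
have ex'' : eigeq (rgraph lvl up') K a lam x.
  apply/eigeq_mul => // v.
  have x'0 u : x' u != 0 by exact: lt0r_neq0.
  have := (eigeq_mul K _ a lam' x'0).1 ex' v; rewrite -lamlam => e.
  rewrite xE exprMn [RHS]mulrCA -e mulrDr; congr (_ + _); first by ring.
  rewrite [RHS]mulrCA; congr (_ * _); rewrite mulr_sumr; apply: eq_bigr => ed /andP[eG _].
  rewrite (eq_bigr _ (fun u _ => xE u)) big_split prodr_const.
  by rewrite (rgraph_uniform rt' eG).
have := (eigeq_mul K _ a lam x_neq0).1 ex'' r.
have := (eigeq_mul K _ a lam x_neq0).1 ex r.
rewrite (deg_rgraph rt K0) (deg_rgraph rt' K0) (sum_rgraph rt K0) (sum_rgraph rt' K0).
rewrite (sum_redge_root rt) (sum_redge_root rt') /cdeg eqxx !add0n => <- E i.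
have sub j : up j = r -> up' j = r by case: (mv j) => ->.
pose P (j : 'I_m) := x r * \prod_(v in block lvl j) x v.
have P0 j : 0 < P j by rewrite mulr_gt0 // prodr_gt0.
have sumE u : rooted K lvl u r ->
    \sum_(j | u j == r) \prod_(v in redge lvl u j) x v = \sum_(j | u j == r) P j.
  by move=> ru; apply: eq_bigr => j /eqP uj; rewrite (prod_redge ru) uj.
rewrite !sumE // in E.
have [//|/= ir] := mv i.
have [->//|ur] := eqVneq (up i) r.
have lt : \sum_(j | up j == r) P j < \sum_(j | up' j == r) P j.
  rewrite [ltRHS](bigD1 i) /=; last by rewrite ir.
  apply: ltr_pwDl; first exact: P0.
  rewrite [leLHS]big_mkcond [leRHS]big_mkcond; apply: ler_sum => j _ /=.
  have [uj|_] := eqVneq (up j) r; last by case: ifP => // _; apply: ltW; apply: P0.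
  have -> : j != i by apply: contraNneq ur => <-; rewrite uj.
  by rewrite (sub j uj) eqxx.
have le2 : (#|[set j | up j == r]| <= #|[set j | up' j == r]|)%N.
  by apply/subset_leq_card/subsetP => j; rewrite !inE => /eqP/sub->.
have : a * #|[set j | up j == r]|%:R * x r ^+ K.+1 +
    (1 - a) * \sum_(j | up j == r) P j <
  a * #|[set j | up' j == r]|%:R * x r ^+ K.+1 +
    (1 - a) * \sum_(j | up' j == r) P j.
  apply: ler_ltD.
    by apply: ler_wpM2r; [exact/exprn_ge0/ltW|rewrite ler_wpM2l // ler_nat].
  by rewrite ltr_pM2l ?subr_gt0.
by rewrite -E ltxx.
Qed.
End MoveBranches.

(** Degree at most 1 at the maximum gives lam <= 1, whereas the constant vector 1 in the Rayleigh
    principle gives (K+1) #|G| <= lam * n <= #|G| K + 1. *)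
Lemma deg_argmax_gt1 (R : realFieldType) n K (G : hgraph n) (a lam : R) x r :
  0 <= a -> a < 1 -> uniform K.+1 G -> (forall v, 0 < x v) -> eigeq G K a lam x ->
  (forall v, x v <= x r) -> (1 < #|G|)%N -> n = (#|G| * K).+1 -> (1 < deg G r)%N.
Proof.
move=> a0 a1 unif x0 ex xr G1 nE; rewrite ltnNge; apply/negP => dr.
have lam1 : lam <= 1.
  rewrite -(ler_pM2r (exprn_gt0 K (x0 r))) -ex.
  have nb : nbr_sum G x r <= x r ^+ K.
    apply: le_trans (_ : (deg G r)%:R * x r ^+ K <= _); last first.
      by rewrite ler_piMl ?exprn_ge0 ?lern1 // ltW.
    rewrite /nbr_sum /deg -sum1_card natr_sum mulr_suml.
    under [leRHS]eq_bigl do rewrite inE.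
    apply: ler_sum => e /andP[eG re]; rewrite mul1r.
    have cev : #|e :\ r| = K by have := cardsD1 r e; rewrite re (unif e eG) => -[].
    rewrite -cev -prodr_const; apply: ler_prod => u _; rewrite xr andbT; exact: ltW.
  apply: le_trans (_ : a * x r ^+ K + (1 - a) * x r ^+ K <= _).
    apply: lerD; last by rewrite ler_wpM2l // subr_ge0 ltW.
    rewrite ler_wpM2r ?exprn_ge0 //; first exact: ltW.
    by apply: ler_piMr => //; rewrite lern1.
  by rewrite -mulrDl addrC subrK.
have := rayleigh a1 unif x0 (fun=> ler01) ex.
rewrite sum_deg.
under eq_bigr do rewrite big1 //; under [X in a * X]eq_bigr => e eG.
  rewrite (eq_bigr (fun=> 1)) => [|v _]; last by rewrite expr1n.
  rewrite sumr_const (unif e eG); over.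
under [X in lam * X]eq_bigr do rewrite expr1n.
rewrite !sumr_const card_ord.
move=> h; have : K.+1%:R * #|G|%:R <= n%:R :> R.
  apply: le_trans (_ : lam * n%:R <= _); last by rewrite ler_piMl // ler0n.
  apply: le_trans h; rewrite -[X in _ <= _ + a * X]mulr_natl.
  rewrite le_eqVlt; apply/orP; left; apply/eqP; ring.
rewrite -natrM ler_nat mulSn mulnC; move: nE G1.
by move: #|G| => g; clear; lia.
Qed.

(** * T_{m,t,k} as a rooted star *)

Section BalancedStar.
Variables (m t K : nat).
Hypotheses (K0 : (0 < K)%N) (t0 : (0 < t)%N) (tm : (t <= m)%N).

Definition T_lvl (v : 'I_(m * K).+1) : nat := if val v is u.+1 then (u %/ K).+1 else 0.

Definition T_up (g : 'I_m) : 'I_(m * K).+1 := inord (T_link t K.+1 g).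

Lemma T_lvl_eq v g : (T_lvl v == g.+1) = (g * K < v)%N && (v <= g.+1 * K)%N.
Proof.
rewrite /T_lvl; case: v => -[|u] hu //=; rewrite eqSS eqn_leq andbC.
by rewrite leq_divRL // -[(_ %/ _ <= _)%N]ltnS ltn_divLR.
Qed.

Lemma T_link_lt g : (g < m)%N -> (T_link t K.+1 g < (m * K).+1)%N.
Proof.
rewrite /T_link => gm; case: (ltnP g t) => // tg; rewrite ltnS leq_mul2r orbC.
by move: t0 tg gm; clear; lia.
Qed.

Lemma val_T_up (g : 'I_m) : val (T_up g) = T_link t K.+1 g.
Proof. by rewrite /T_up /= inordK // T_link_lt. Qed.

Lemma T_lvl_up (g : 'I_m) : T_lvl (T_up g) = if (g < t)%N then 0%N else (g - t).+1.
Proof.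
rewrite /T_lvl val_T_up /T_link; case: ltnP => // tg.
have -> : ((g - t).+1 * K = ((g - t) * K + K.-1).+1)%N.
  by rewrite mulSn addnC -addnS prednK.
by rewrite divnMDl // divn_small ?addn0 // prednK.
Qed.

Lemma T_edgeE (g : 'I_m) : T_edge m t K.+1 g = redge T_lvl T_up g.
Proof.
apply/setP => v; rewrite mem_redge T_lvl_eq inE orbC; congr (_ || _).
by rewrite eq_sym -val_T_up.
Qed.

Lemma T_rooted : rooted K T_lvl T_up ord0.
Proof.
split.
- by case=> -[|u] hu.
- move=> v; rewrite /T_lvl; case: v => -[|u] //= hu.
  by rewrite ltn_divLR.
- move=> i; have lt (j : 'I_K) : (i * K + j.+1 < (m * K).+1)%N.
    rewrite ltnS; apply: leq_trans (_ : i.+1 * K <= _)%N.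
      by rewrite mulSnr leq_add2l.
    by rewrite leq_mul2r ltn_ord orbT.
  rewrite -[RHS]card_ord -(card_imset predT (_ : injective (fun j => Ordinal (lt j)))).
    apply: eq_card => v; rewrite inE T_lvl_eq; apply/andP/imsetP => [[h1 h2]|[j _ ->]] /=.
      have h : (v - (i * K).+1 < K)%N by move: h1 h2; rewrite mulSnr; clear; lia.
      by exists (Ordinal h) => //; apply: val_inj; move: h1 => /=; clear; lia.
    by rewrite mulSnr leq_add2l -addSnnS leq_addr.
  by move=> j l [] /eqP; rewrite eqn_add2l => /eqP[] /val_inj.
move=> i; rewrite T_lvl_up; case: ltnP => // ti; move: t0 ti; clear; lia.
Qed.

Lemma TmtkE : Tmtk m t K.+1 = rgraph T_lvl T_up.
Proof. by apply: eq_imset => g; apply: T_edgeE. Qed.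

Lemma T_starlike : starlike T_lvl T_up.
Proof.
move=> i j; rewrite !T_lvl_up; case: ltnP => // ti; case: ltnP => // tj [e] _.
by apply: val_inj; move: ti tj e; rewrite /=; clear; lia.
Qed.

Lemma T_root_edge (i : 'I_m) : (i \in root_edges T_up ord0) = (i < t)%N.
Proof.
by rewrite inE -(rooted_lvl0 T_rooted) T_lvl_up; case: ltnP.
Qed.

Lemma card_T_root_edges : #|root_edges T_up ord0| = t.
Proof.
rewrite -sum1_card; under eq_bigl do rewrite T_root_edge.
by rewrite (big_ord_narrow tm) sum1_card card_ord.
Qed.

(** From g on, the leg consists of the edges g, g + t, g + 2t, ... below m. *)
Lemma T_height h : is_height T_lvl T_up h -> forall g : 'I_m, h g = ((m - g).-1 %/ t).+1.
Proof.
move=> hh g; have [k] := ubnP (m - g); elim: k g => // k IH g gk.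
rewrite hh; congr _.+1; have [gt|gt] := ltnP (g + t) m.
  rewrite (big_pred1 (Ordinal gt)) => [|j]; last first.
    rewrite /= T_lvl_up; case: ltnP => tj.
      by apply/esym/eqP => /(congr1 val) /=; move: tj; clear; lia.
    rewrite eqSS; apply/eqP/eqP => [e|->]; last by rewrite /= addnK.
    by apply: val_inj; rewrite /=; move: e tj; clear; lia.
  rewrite IH /=; last by move: gk t0 gt; clear; lia.
  have -> : ((m - g).-1 = (m - (g + t)).-1 + t)%N by move: gt; clear; lia.
  by rewrite divnDr // divnn t0 addn1.
rewrite big_pred0 => [|j]; last first.
  rewrite T_lvl_up; case: ltnP => // tj; apply/eqP.
  by move: (ltn_ord j) tj gt; clear; lia.
by rewrite divn_small //; move: gt (ltn_ord g); clear; lia.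
Qed.

Lemma T_balanced h : is_height T_lvl T_up h -> balanced (root_edges T_up ord0) h.
Proof.
move=> /T_height hE i j; rewrite !T_root_edge => it jt; rewrite !hE ltnS.
have -> : (((m - j).-1 %/ t).+1 = ((m - j).-1 + t) %/ t)%N by rewrite divnDr // divnn t0 addn1.
by apply: leq_div2r; move: jt; clear; lia.
Qed.
End BalancedStar.

(** * A balanced star is isomorphic to T_{m,t,k} *)

Section StarIsomorphism.
Variables (n m K t : nat) (lvl : 'I_n -> nat) (up : 'I_m -> 'I_n) (r : 'I_n) (h : 'I_m -> nat).
Hypotheses (K0 : (0 < K)%N) (t0 : (0 < t)%N) (rt : rooted K lvl up r).
Hypotheses (star : starlike lvl up) (hh : is_height lvl up h).
Hypotheses (ct : #|root_edges up r| = t) (bal : balanced (root_edges up r) h).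

Let L := root_edges up r.
Let q := (m %/ t)%N.

Let tm : (t <= m)%N.
Proof. by rewrite -ct -[leqRHS]card_ord max_card. Qed.

(** [balanced_sum] for an indicator counts the legs of each length; it is applied over int because
    it asks for a ring. *)
Let sum_ind (p : nat -> bool) : (\sum_(i in L) p (h i) =
  p q * (t - m %% t) + p q.+1 * (m %% t))%N.
Proof.
have L0 : (0 < #|L|)%N by rewrite ct.
have := @balanced_sum _ L int (fun z => (p z)%:R) h L0 bal.
rewrite /= ct (sum_height rt hh) -/q -!mulrnA -natrD -natr_sum.
by move/eqP; rewrite eqr_nat => /eqP.
Qed.

Let h_cases i : i \in L -> h i = q \/ h i = q.+1.
Proof.
move=> iL; have := sum_ind (fun z => (z != q) && (z != q.+1)).
rewrite !eqxx andbF !mul0n addn0 => /eqP; rewrite sum_nat_eq0 => /forall_inP/(_ i iL).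
by rewrite eqb0 negb_and !negbK => /orP[/eqP|/eqP]; [left|right].
Qed.

(** The long legs are ranked first because in T_{m,t,k} the legs numbered below m %% t are the long
    ones. *)
Let long := [seq i <- enum L | h i == q.+1].
Let short := [seq i <- enum L | h i != q.+1].

Let size_long : size long = (m %% t)%N.
Proof.
have := sum_ind (fun z => z == q.+1); rewrite eqxx mul1n.
rewrite (_ : (q == q.+1) = false) ?add0n; last by apply/eqP; clear; lia.
move=> <-; rewrite size_filter -sum1_count big_enum_cond /= big_mkcondr.
by apply: eq_bigr => i _; case: eqP.
Qed.

Let rank i := index i (long ++ short).

Let mem_ranked i : (i \in long ++ short) = (i \in L).
Proof.
rewrite mem_cat mem_filter [X in _ || X]mem_filter mem_enum.
by case: (h i == q.+1); rewrite /= ?orbF.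
Qed.

Let size_ranked : size (long ++ short) = t.
Proof. by rewrite /long /short size_cat !size_filter count_predC -cardE ct. Qed.

Let rank_lt i : i \in L -> (rank i < t)%N.
Proof. by rewrite -mem_ranked -index_mem size_ranked. Qed.

Let rank_inj i j : i \in L -> j \in L -> rank i = rank j -> i = j.
Proof.
rewrite -!mem_ranked => iL jL e.
by rewrite -(nth_index i iL) -(nth_index i jL) -/(rank i) e.
Qed.

(** The left side is the number that the last edge of leg i will receive. *)
Let rank_bound i : i \in L -> (rank i + t * (h i).-1 < m)%N.
Proof.
move=> iL; have mE := divn_eq m t; rewrite -/q in mE.
have rt' := rank_lt iL.
have q0 : (0 < q)%N by rewrite divn_gt0.
have [hi|hi] := h_cases iL.
  rewrite hi [X in (_ < X)%N]mE; apply: leq_trans (_ : q * t <= _)%N; last exact: leq_addr.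
  by rewrite -{2}(prednK q0) mulSn [(_ * t)%N]mulnC -addSn leq_add2r.
have ir : (rank i < m %% t)%N.
  rewrite -size_long /rank index_cat.
  have il : i \in long by rewrite mem_filter hi eqxx mem_enum.
  by rewrite il index_mem.
by rewrite hi [X in (_ < X)%N]mE /= mulnC addnC ltn_add2l.
Qed.

(* Number edges as in T_{m,t,k}: the rank of the leg plus t times the depth in it. *)
Let position : exists phi : 'I_m -> nat,
  (forall i, i \in L -> phi i = rank i) /\
  (forall i p : 'I_m, lvl (up i) = p.+1 -> phi i = phi p + t)%N.
Proof.
pose step (i : 'I_m) (phi : 'I_m -> nat) :=
  (if [pick p : 'I_m | lvl (up i) == p.+1] is Some p then phi p + t else rank i)%N.
have [phi phiE] : exists phi, forall i, phi i = step i phi.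
  apply: (@measure_rec _ nat (fun i : 'I_m => i : nat) 0%N) => i f g fg; rewrite /step.
  case: pickP => // p /eqP lp; rewrite fg //.
  by have := rooted_up rt i; rewrite lp.
exists phi; split=> [i|i p lp].
  rewrite inE => /eqP iL; rewrite phiE /step; case: pickP => // p.
  by rewrite iL (lvl_root rt).
rewrite phiE /step; case: pickP => [p'|/(_ p)]; last by rewrite lp eqxx.
by rewrite lp eqSS => /eqP /val_inj ->.
Qed.

(* T_{m,t,k} attaches the next edge of a path at the last vertex of a block, so the
   vertex of a block where the path continues is listed last. *)
Let connector (i : 'I_m) := [pick v in block lvl i | [exists j, up j == v]].
Let listing i := if connector i is Some c then rcons (enum (block lvl i :\ c)) c
  else enum (block lvl i).

Let mem_listing i v : (v \in listing i) = (v \in block lvl i).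
Proof.
rewrite /listing /connector; case: pickP => [c /andP[ci _]|_]; last by rewrite mem_enum.
by rewrite mem_rcons in_cons mem_enum in_setD1; case: eqVneq => [->|].
Qed.

Let size_listing i : size (listing i) = K.
Proof.
rewrite -(rooted_block rt i) -/(block lvl i) /listing /connector.
case: pickP => [c /andP[ci _]|_]; last by rewrite -cardE.
by rewrite size_rcons -cardE [RHS](cardsD1 c) ci.
Qed.

Let index_connector i j : up j \in block lvl i -> index (up j) (listing i) = K.-1.
Proof.
move=> ui; have := size_listing i; rewrite /listing /connector; case: pickP => [c|/(_ (up j))].
  move=> /andP[ci /existsP[j' /eqP jc]].
  have -> : up j = c.
    rewrite -jc; congr up; apply: star; last by move: ui; rewrite inE => /eqP->.
    by move: ui ci; rewrite -jc !inE => /eqP-> /eqP->.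
  rewrite size_rcons => <-; rewrite -cats1 index_cat ifN ?mem_enum ?in_setD1 ?eqxx //=.
  by rewrite eqxx addn0.
by rewrite ui => /negbT /existsP[]; exists j.
Qed.

Theorem balanced_star_hiso : hiso (rgraph lvl up) (Tmtk m t K.+1).
Proof.
have [phi [phi_root phi_child]] := position.
have parent i : up i != r -> exists2 p : 'I_m, up i \in block lvl p & lvl (up i) = p.+1.
  move=> ur; exists (own rt ur); first exact: mem_own.
  by apply/eqP; rewrite (ownE rt ur).
(* The number of the last edge of the leg is the same computed from any edge on it: one step down
   adds t to phi and lowers h by one. *)
have phi_bound i : (phi i + t * (h i).-1 < m)%N.
  have [k] := ubnP (i : nat); elim: k i => // k IH i ik.
  have [ur|ur] := boolP (i \in L); first by rewrite phi_root // rank_bound.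
  rewrite inE in ur; have [p _ lp] := parent i ur.
  have pi : (p < k)%N by have := rooted_up rt i; rewrite lp; move: ik; clear; lia.
  have := IH p pi; rewrite (phi_child i p lp).
  have -> : h p = (h i).+1.
    rewrite hh (big_pred1 i) // => j /=; apply/eqP/eqP => [lj|->//].
    by apply: star; rewrite lj ?lp.
  have : (0 < h i)%N by rewrite hh.
  by case: (h i) => // x _; rewrite /= mulnS addnA.
have phi_lt i : (phi i < m)%N by apply: leq_ltn_trans (phi_bound i); apply: leq_addr.
have phi_inj : injective phi.
  move=> i; have [k] := ubnP (i : nat); elim: k i => // k IH i ik j e.
  have [iL|iL] := boolP (i \in L); have [jL|jL] := boolP (j \in L).
  - by apply: rank_inj => //; rewrite -!phi_root.
  - rewrite inE in jL; have [p _ lp] := parent j jL.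
    by have := rank_lt iL; rewrite -phi_root // e (phi_child j p lp); clear; lia.
  - rewrite inE in iL; have [p _ lp] := parent i iL.
    by have := rank_lt jL; rewrite -phi_root // -e (phi_child i p lp); clear; lia.
  rewrite inE in iL; have [p _ lp] := parent i iL.
  rewrite inE in jL; have [p' _ lp'] := parent j jL.
  apply: star; last by rewrite lp.
  rewrite lp lp'; congr _.+1.
  move/eqP: e; rewrite (phi_child i p lp) (phi_child j p' lp') eqn_add2r => /eqP e.
  rewrite (IH p _ _ e) //.
  by have := rooted_up rt i; rewrite lp; move: ik; clear; lia.
(* As in T_{m,t,k}, r goes to 0 and the block of i fills the K places after phi i * K. *)
pose pos v := if [pick i : 'I_m | v \in block lvl i] is Some i
  then (phi i * K + (index v (listing i)).+1)%N else 0%N.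
have pos_root : pos r = 0%N.
  by rewrite /pos; case: pickP => // i; rewrite inE (lvl_root rt).
have pos_block (i : 'I_m) v : v \in block lvl i -> pos v = (phi i * K + (index v (listing i)).+1)%N.
  move=> vi; rewrite /pos; case: pickP => [j vj|/(_ i)]; last by rewrite vi.
  suff -> : j = i by [].
  by apply: val_inj; move: vi vj; rewrite !inE => /eqP-> /eqP[].
have index_lt (i : 'I_m) v : v \in block lvl i -> (index v (listing i) < K)%N.
  by rewrite -mem_listing -index_mem size_listing.
have pos_lt v : (pos v < (m * K).+1)%N.
  have [->|vr] := eqVneq v r; first by rewrite pos_root.
  have vi := mem_own rt vr; rewrite (pos_block _ _ vi) ltnS.
  apply: leq_trans (_ : (phi (own rt vr)).+1 * K <= _)%N.
    by rewrite mulSnr leq_add2l index_lt.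
  by rewrite leq_mul2r phi_lt orbT.
pose f v := Ordinal (pos_lt v).
have f_inj : injective f.
  move=> v w /(congr1 val) /= e.
  have [vr|vr] := eqVneq v r; have [wr|wr] := eqVneq w r; first by rewrite vr wr.
  - by move: e; rewrite vr pos_root (pos_block _ _ (mem_own rt wr)) addnS.
  - by move: e; rewrite wr pos_root (pos_block _ _ (mem_own rt vr)) addnS.
  have vi := mem_own rt vr; have wi := mem_own rt wr.
  move: e; rewrite (pos_block _ _ vi) (pos_block _ _ wi) !addnS => -[e].
  have ephi : phi (own rt vr) = phi (own rt wr).
    have := congr1 (divn^~ K) e.
    by rewrite /= !divnMDl // !divn_small ?addn0 // index_lt.
  have eown := phi_inj _ _ ephi.
  move: e; rewrite ephi => /eqP; rewrite eqn_add2l eown => /eqP e.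
  have := vi; rewrite eown -mem_listing => vl.
  have := wi; rewrite -mem_listing => wl.
  move: vl wl e; move: (listing _) => s vs ws e.
  by rewrite -(nth_index v vs) -(nth_index v ws) e.
have f_bij : bijective f.
  by apply: inj_card_bij f_inj _; rewrite !card_ord (card_rooted rt).
have f_edge i : f @: redge lvl up i = T_edge m t K.+1 (phi i).
  pose g := Ordinal (phi_lt i).
  have -> : phi i = val g by [].
  rewrite (@T_edgeE m t K K0 t0 g); apply/eqP; rewrite eqEcard; apply/andP; split; last first.
    rewrite (rgraph_uniform (@T_rooted m t K K0 t0)) ?imset_f //.
    by rewrite card_imset // (rgraph_uniform rt) ?imset_f.
  rewrite -(@T_edgeE m t K K0 t0 g); apply/subsetP => w /imsetP[v + ->].
  rewrite mem_redge inE /= => /orP[/eqP<-|lv]; last first.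
    have vi : v \in block lvl i by rewrite inE.
    by rewrite (pos_block i) // addnS ltnS leq_addr -addnS mulSnr leq_add2l index_lt.
  have [ur|ur] := eqVneq (up i) r.
    have iL : i \in L by rewrite inE ur.
    by rewrite ur pos_root /T_link phi_root // rank_lt //= orbT.
  have [p ui lp] := parent i ur.
  rewrite (pos_block p) // index_connector // prednK // /T_link (phi_child i p lp).
  have -> : (phi p + t < t)%N = false by rewrite ltnNge leq_addl.
  by rewrite addnK /= [((phi p).+1 * _)%N]mulSnr eqxx orbT.
exists f; split=> // e; apply/imsetP/imsetP => [[i _ ->]|[g _ fe]].
  by exists (Ordinal (phi_lt i)); rewrite ?f_edge.
have [psi psiK phiK] : bijective (fun i => Ordinal (phi_lt i)).
  by apply: injF_bij => i j /(congr1 val) /= /phi_inj.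
exists (psi g) => //; apply: (imset_inj f_inj).
by rewrite f_edge fe -{1}(phiK g).
Qed.
End StarIsomorphism.

(** * Eigenpairs of rooted trees and the final comparison *)

Section PerronPairs.
Variables (R : rcfType) (n m K : nat) (a : R) (lvl : 'I_n -> nat).
Variables (up : 'I_m -> 'I_n) (r : 'I_n).
Hypotheses (a_ge0 : 0 <= a) (a_lt1 : a < 1) (K0 : (0 < K)%N) (m0 : (0 < m)%N).
Hypothesis rt : rooted K lvl up r.

Lemma exists_perron_pair : exists lam x,
  [/\ 0 <= lam, forall v, 0 < x v & eigeq (rgraph lvl up) K a lam x].
Proof.
have [lam [g [bb [gr g0 bb0 bbE gE]]]] := perron_recursion a_ge0 a_lt1 K0 m0 rt.
have [x [x0 ex _]] := perron_vector rt K0 a_lt1 gr g0 bb0 bbE gE.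
have := recursion_gap_gt0 rt a_ge0 K0 m0 g0 bb0 gE.
by rewrite subr_gt0 => alam; exists lam, x; split=> //; apply: le_trans (ltW alam).
Qed.

Lemma starlike_perron_pair h : starlike lvl up -> is_height lvl up h ->
  exists lam x, [/\ 0 <= lam, forall v, 0 < x v, eigeq (rgraph lvl up) K a lam x,
    legs_at K a lam (root_edges up r) h &
    (forall v, x v <= x r) -> #|root_edges up r| = 2 -> balanced (root_edges up r) h].
Proof.
move=> star hh.
have [lam [g [bb [gr g0 bb0 bbE gE]]]] := perron_recursion a_ge0 a_lt1 K0 m0 rt.
have [x [x0 ex xE]] := perron_vector rt K0 a_lt1 gr g0 bb0 bbE gE.
have gap := recursion_gap_gt0 rt a_ge0 K0 m0 g0 bb0 gE.
exists lam, x; split=> //.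
- by apply: le_trans a_ge0 _; rewrite -subr_ge0 ltW.
- split=> // [i _|].
    by have [] := starlike_branch rt a_ge0 a_lt1 K0 m0 g0 bb0 bbE gE star hh i.
  rewrite (starlike_sum rt a_ge0 a_lt1 K0 m0 gr g0 bb0 bbE gE star hh).
  exact: subrK.
move=> xr; exact: (two_legs_balanced rt a_ge0 a_lt1 K0 m0 gr g0 bb0 bbE gE star hh x0 xr xE).
Qed.
End PerronPairs.

Theorem theorem5p4 (C : numClosedFieldType) (k n m t : nat) (a : C)
    (G : {set {set 'I_n}}) :
  (2 <= k)%N -> 0 <= a < 1 ->
  uniform k G -> hypertree G -> #|G| = m ->
  #|pendant_edges G| = t -> (2 <= t)%N ->
  exists rG rT : C,
    [/\ spectral_radius (A_alpha k a G) rG,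
        spectral_radius (A_alpha k a (Tmtk m t k)) rT,
        rG <= rT &
        (rG = rT <-> hiso G (Tmtk m t k))].
Proof.
case: k => // K K0 /andP[a_ge0 a_lt1] unif [conn acyc] cG cP t2.
pose al : realC C := RealC (ger0_real a_ge0).
have al0 : 0 <= al by rewrite -valC_le.
have al1 : al < 1 by rewrite -valC_lt.
have tm : (t <= m)%N.
  rewrite -cP -cG; apply/subset_leq_card/subsetP => e.
  by rewrite inE => /andP[].
have t0 : (0 < t)%N by apply: ltnW.
have m0 : (0 < m)%N by apply: leq_trans tm.
have [r0 _] : exists r0 : 'I_n, true.
  have /card_gt0P[e eG] : (0 < #|G|)%N by rewrite cG.
  have /card_gt0P[v _] : (0 < #|e|)%N by rewrite (unif e eG).
  by exists v.
have n0 : (0 < n)%N by apply: leq_ltn_trans (ltn_ord r0).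
(* The arbitrary root r0 only serves to produce the eigenvector x; the tree is then rooted again at
   a maximum of x. *)
have [lvl0 [up0 [rt0 GE0]]] := hypertree_rooted r0 K0 unif cG conn acyc.
have [lamG [x [lamG0 x0]]] := exists_perron_pair al0 al1 K0 m0 rt0.
rewrite -GE0 => ex.
have [r _ rmax] := @arg_maxP _ _ _ r0 predT x isT.
have xr v : x v <= x r by apply: rmax.
have [lvl [up [rt GE]]] := hypertree_rooted r K0 unif cG conn acyc.
have dr : (1 < deg G r)%N.
  apply: deg_argmax_gt1 al0 al1 unif x0 ex xr _ _; rewrite cG ?(card_rooted rt) //.
  exact: leq_trans tm.
pose up' := moved_up lvl up r.
have rt' : rooted K lvl up' r := rooted_moved rt.
have star' : starlike lvl up' := starlike_moved rt.
have [h' hh'] := exists_height rt'.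
have [lamS [x' [lamS0 x'0 ex' legs' two]]] := starlike_perron_pair al0 al1 K0 m0 rt' star' hh'.
have cS : #|root_edges up' r| = t.
  by rewrite (card_root_edges_moved rt) -(card_pendant_edges rt K0) -?GE.
have rtT := @T_rooted m t K K0 t0.
have [hT hhT] := exists_height rtT.
have [lamT [xT [lamT0 xT0 exT legsT _]]] :=
  starlike_perron_pair al0 al1 K0 m0 rtT (@T_starlike m t K K0 t0) hhT.
have cT := @card_T_root_edges m t K K0 t0 tm.
rewrite -(@TmtkE m t K K0 t0) in exT.
have unifT : uniform K.+1 (Tmtk m t K.+1).
  by rewrite (@TmtkE m t K K0 t0); apply: rgraph_uniform rtT.
have srG := spectral_radius_eigeq al0 (ltW al1) lamG0 unif n0 x0 ex.
have srT := spectral_radius_eigeq al0 (ltW al1) lamT0 unifT (ltn0Sn _) xT0 exT.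
have mv i : up' i = up i \/ up' i = r by rewrite /up' /moved_up; case: ifP; [left|right].
have exG : eigeq (rgraph lvl up) K al lamG x by rewrite -GE.
have leGS : lamG <= lamS := move_le K0 rt rt' al0 al1 x0 x'0 exG ex' xr mv.
have cST : #|root_edges up' r| = #|root_edges (@T_up m t K) ord0| by rewrite cS cT.
have cS1 : (1 < #|root_edges up' r|)%N by rewrite cS.
have h'0 i : i \in root_edges up' r -> (0 < h' i)%N by rewrite hh'.
have sST : (\sum_(i in root_edges up' r) h' i =
    \sum_(i in root_edges (@T_up m t K) ord0) hT i)%N.
  by rewrite (sum_height rt' hh') (sum_height rtT hhT).
have balT := @T_balanced m t K K0 t0 hT hhT.
have leST : lamS <= lamT := legs_compare al0 al1 legs' legsT cST cS1 h'0 sST balT.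
exists (valC lamG), (valC lamT); split=> //; first exact: le_trans leST.
split=> [eGT|[f [bf fG]]]; last first.
  have exf := eigeq_hiso bf fG exT.
  apply: spectral_radius_uniq srG _.
  exact: (spectral_radius_eigeq al0 (ltW al1) lamT0 unif n0 (fun v => xT0 (f v)) exf).
have {}eGT : lamG = lamT by apply: val_inj.
have leSG : lamS <= lamG by rewrite eGT.
have upE := move_eq K0 rt rt' al0 al1 x0 x'0 exG ex' xr mv leSG.
have ratio := move_eq_ratio K0 rt rt' al0 al1 x0 x'0 exG ex' xr mv leSG.
have -> : G = rgraph lvl up'.
  by rewrite GE; apply: eq_imset => i; rewrite /redge upE.
apply: (balanced_star_hiso K0 t0 rt' star' hh' cS).
(* With two legs no transfer is strict, and [two] takes over; it needs x' maximal at r, which holds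
   because x' is proportional to x. *)
have [t3|t3] := ltnP 2 #|root_edges up' r|.
  by apply: legs_compare_eq al0 al1 legs' legsT cST cS1 h'0 sST balT _ t3; rewrite -eGT.
apply: two; last by apply/eqP; rewrite eqn_leq t3.
move=> v; have s0 : 0 < x r / x' r by rewrite divr_gt0.
have xE w : x w = (x r / x' r) * x' w by rewrite -(ratio w) divfK // lt0r_neq0.
by have := xr v; rewrite (xE v) [leRHS]xE ler_pM2l.
Qed.
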